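(* Let $(\rho_i)_{i\ge1}$ be real numbers and let $(a_{ij})_{i,j\ge1}$ be real random variables such that $\{a_{ii}:i\ge1\}\cup\{(a_{ij},a_{ji}):1\le i<j\}$ is an independent collection, $\mathbf{E}[a_{ij}]=0$ and $\mathbf{E}[a_{ij}^2]=1$ for all $i,j$, $\sup_{i,j}\mathbf{E}|a_{ij}|^q<\infty$ for every $q\in\mathbb{N}$, and $\mathbf{E}[a_{ij}a_{ji}]=\rho_{|i-j|}$ for all $i\ne j$. Let $X_{p\times n}=(a_{ij})_{1\le i\le p,\,1\le j\le n}$, where $n=n(p)$ satisfies $\frac pn\to y>0$ as $p\to\infty$, and let $\bar X_p=\frac1nX_{p\times n}X_{p\times n}'$, where $'$ denotes transpose. Then, as $p\to\infty$, $\bar X_p$ converges in distribution to a free Poisson element of rate $y$, and its expected empirical spectral distribution converges weakly to the corresponding Marčenko–Pastur law with parameter $y$.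
   Context: For $p\times p$ random matrices with all moments finite, $\varphi_p(x)=\frac1p\mathbf{E}\,\mathrm{Tr}(x)$. A sequence of symmetric random matrices $B_p$ (of size $p\times p$) converges in distribution to a self-adjoint element $b$ of a non-commutative probability space $(\mathcal{A},\varphi)$ (a unital complex $*$-algebra with a state) if $\lim_p\varphi_p(B_p^k)=\varphi(b^k)$ for all integers $k\ge0$. The empirical spectral distribution (ESD) of a matrix with eigenvalues $\lambda_1,\ldots,\lambda_p$ is the distribution function of $\frac1p\sum_k\delta_{\lambda_k}$; the expected ESD is its expectation. The Marčenko–Pastur law with parameter $y>0$ is the probability measure $\mu$ on $\mathbb{R}$ given by $\mu(A)=\left(1-\frac1y\right)\mathbf{1}_{\{0\in A\}}+\nu(A)$ if $y>1$ and $\mu(A)=\nu(A)$ if $y\le1$, where $d\nu(x)=\frac{1}{2\pi xy}\sqrt{(b-x)(x-a)}\,dx$ on $[a,b]$ and $0$ elsewhere, with $a=(1-\sqrt y)^2$, $b=(1+\sqrt y)^2$. A free Poisson element of rate $y$ here means a self-adjoint element whose moments are those of the Marčenko–Pastur law with parameter $y$. *)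

(* Defs.v *)
From HB Require Import structures.
From mathcomp Require Import all_boot all_order all_algebra.
From mathcomp Require Import finmap complex.
From mathcomp Require Import all_classical all_reals all_analysis.
From mathcomp Require Import measurable_realfun.

Set Implicit Arguments.
Unset Strict Implicit.
Unset Printing Implicit Defensive.

Import Order.TTheory GRing.Theory Num.Theory.
Import numFieldNormedType.Exports.

Local Open Scope classical_set_scope.
Local Open Scope ring_scope.

Section independence.
Context d (T : measurableType d) (R : realType) (P : probability T R).

Definition generated_sigma_algebra d' (T' : measurableType d') (X : T -> T') :
    set (set T) :=
  preimage_set_system [set: T] X (@measurable _ T').

Definition mutually_independent (I : choiceType) (D : set I)
    (G : I -> set (set T)) : Prop :=
  forall (J : {fset I}) (E : I -> set T),
    [set` J] `<=` D ->
    (forall i, i \in J -> G i (E i)) ->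
    P (\bigcap_(i in [set` J]) E i) = (\prod_(i <- J) P (E i))%E.

(* The members of the collection live in different spaces: [inl i] stands for
   the real variable a_ii and [inr (i, j)] for the R^2-valued variable
   (a_ij, a_ji), the latter being used for i < j only. *)
Definition entry_index : set (nat + nat * nat) :=
  [set b | match b with inl _ => True | inr ij => (ij.1 < ij.2)%N end].

Definition entry_sigma_algebra (a : nat -> nat -> T -> R)
    (b : nat + nat * nat) : set (set T) :=
  match b with
  | inl i => generated_sigma_algebra (a i i)
  | inr (i, j) =>
      generated_sigma_algebra (fun t => (a i j t, a j i t) : (R * R)%type)
  end.

Definition independent_entries (a : nat -> nat -> T -> R) : Prop :=
  mutually_independent entry_index (entry_sigma_algebra a).

End independence.

Record ncProbSpace (R : realType) := NCProbSpace {
  nc_alg :> algType R[i] ;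
  nc_star : nc_alg -> nc_alg ;
  nc_starK : involutive nc_star ;
  nc_starD : {morph nc_star : x y / x + y} ;
  nc_starM : forall x y, nc_star (x * y) = nc_star y * nc_star x ;
  nc_starZ : forall (c : R[i]) x, nc_star (c *: x) = conjc c *: nc_star x ;
  nc_state : {scalar nc_alg} ;
  nc_state1 : nc_state 1 = 1 ;
  nc_state_ge0 : forall x, 0 <= nc_state (nc_star x * x)
}.

Definition nc_selfadjoint (R : realType) (A : ncProbSpace R) (b : A) : Prop :=
  nc_star b = b.

Section random_matrices.
Context d (T : measurableType d) (R : realType) (P : probability T R).

Definition phi_ p (M : T -> 'M[R]_p) : R :=
  p%:R^-1 * fine 'E_P[fun t => \tr (M t)].

(* [R[i]^o] carries the usual topology of the complex numbers. *)
Definition cvg_in_distribution (B : forall p, T -> 'M[R]_p)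
    (A : ncProbSpace R) (b : A) : Prop :=
  forall k : nat,
    (real_complex R (phi_ (fun t => B p t ^+ k)) : R[i]^o) @[p --> \oo]
      --> (nc_state A (b ^+ k) : R[i]^o).

End random_matrices.

Section spectral_distribution.
Context (R : realType).

(* Real eigenvalues with algebraic multiplicity. The list exists, and is unique
   up to order, when A is symmetric; it is [::] if no such list exists. *)
Definition eigenvalues p (A : 'M[R]_p) : seq R :=
  xget [::] [set s | char_poly A = \prod_(l <- s) ('X - l%:P)].

Definition empirical_spectral_measure p (A : 'M[R]_p) : set R -> \bar R :=
  mscale (p%:R^-1 : R)%:nng
    (msum (fun k => \d_((eigenvalues A)`_k) : {measure set R -> \bar R}) p).

Definition distribution_function (mu : set R -> \bar R) (x : R) : R :=
  fine (mu `]-oo, x]%classic).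

Definition esd p (A : 'M[R]_p) : R -> R :=
  distribution_function (empirical_spectral_measure A).

Definition expected_esd d (T : measurableType d) (P : probability T R) p
    (M : T -> 'M[R]_p) (x : R) : R :=
  fine 'E_P[fun t => esd (M t) x].

Definition weak_cvg_df (F : nat -> R -> R) (G : R -> R) : Prop :=
  forall x : R, {for x, continuous G} -> F p x @[p --> \oo] --> G x.

End spectral_distribution.

Section marchenko_pastur.
Context (R : realType) (y : R).

Definition mp_left : R := (1 - Num.sqrt y) ^+ 2.
Definition mp_right : R := (1 + Num.sqrt y) ^+ 2.

Definition mp_density (x : R) : R :=
  if mp_left <= x <= mp_right
  then (2 * pi * x * y)^-1 * Num.sqrt ((mp_right - x) * (x - mp_left))
  else 0.

Definition mp_ac (A : set R) : \bar R :=
  (\int[lebesgue_measure]_(x in A) (mp_density x)%:E)%E.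

Definition marchenko_pastur (A : set R) : \bar R :=
  if 1 < y then ((1 - y^-1)%:E * \d_(0%R : R) A + mp_ac A)%E else mp_ac A.

Lemma mp_density_ge0 x : 0 <= mp_density x.
Proof.
rewrite /mp_density; case: ifPn => // /andP[ax xb].
have [y0|y0] := leP y 0.
  move: ax xb; rewrite /mp_left /mp_right ler0_sqrtr// subr0 addr0 => ax xb.
  have -> : x = 1 ^+ 2 by apply/eqP; rewrite eq_le ax xb.
  by rewrite subrr mul0r sqrtr0 mulr0.
rewrite mulr_ge0 ?sqrtr_ge0// invr_ge0 !mulr_ge0 ?pi_ge0// ?(ltW y0)//.
by rewrite (le_trans _ ax)// sqr_ge0.
Qed.

Let measurable_invr : measurable_fun [set: R] (@GRing.inv R).
Proof.
rewrite (_ : @GRing.inv R = fun x => if x == 0 then 0 else x^-1); last first.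
  by apply/funext => x; case: eqP => // ->; rewrite invr0.
apply: measurable_fun_if => //; first exact: measurable_fun_eqr.
rewrite setTI (_ : _ @^-1` _ = [set x | x != 0]); last first.
  by apply/seteqP; split => [x /= /negbT|x /= /negbTE].
apply: open_continuous_measurable_fun => //; apply/in_setP => x /= x0.
exact: inv_continuous.
Qed.

Lemma measurable_mp_density : measurable_fun [set: R] mp_density.
Proof.
rewrite /mp_density; apply: measurable_fun_if => //=.
  by apply: measurable_and => //; exact: measurable_fun_ler.
apply: measurable_funTS; apply: measurable_funM.
  apply: measurableT_comp; first exact: measurable_invr.
  by do 2 apply: measurable_funM => //.
apply: measurableT_comp.
  by apply: continuous_measurable_fun; exact: sqrt_continuous.
by apply: measurable_funM; apply: measurable_funB.
Qed.

Let mp_ac0 : mp_ac set0 = 0%E.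
Proof. exact: integral_set0. Qed.

Let mp_ac_ge0 A : (0 <= mp_ac A)%E.
Proof. by apply: integral_ge0 => x _; rewrite lee_fin mp_density_ge0. Qed.

Let mp_ac_sigma_additive : semi_sigma_additive mp_ac.
Proof.
move=> /= F mF tF mUF; rewrite /mp_ac; apply: cvg_toP.
  apply: ereal_nondecreasing_is_cvgn => m n mn.
  by apply: lee_sum_nneg_natr => // k _ _; exact: mp_ac_ge0.
rewrite ge0_integral_bigcup//=.
- apply: measurable_funTS; apply: measurableT_comp => //.
  exact: measurable_mp_density.
- by move=> x _; rewrite lee_fin mp_density_ge0.
Qed.

HB.instance Definition _ := isMeasure.Build _ _ _ mp_ac
  mp_ac0 mp_ac_ge0 mp_ac_sigma_additive.

Let mp_atom : R := if 1 < y then 1 - y^-1 else 0.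

Let mp_atom_ge0 : 0 <= mp_atom.
Proof.
rewrite /mp_atom; case: ifPn => // y1.
by rewrite subr_ge0 invf_le1 ?(lt_trans _ y1)// ltW.
Qed.

Let mp_measureE :
  marchenko_pastur = measure_add (mscale (NngNum mp_atom_ge0) \d_(0%R : R)) mp_ac.
Proof.
apply/funext => A; rewrite measure_addE.
transitivity (mp_atom%:E * \d_(0%R : R) A + mp_ac A)%E => //.
by rewrite /marchenko_pastur /mp_atom; case: ifPn => // _; rewrite mul0e add0e.
Qed.

Let mp0 : marchenko_pastur set0 = 0%E.
Proof. rewrite mp_measureE; exact: measure0. Qed.

Let mp_ge0 A : (0 <= marchenko_pastur A)%E.
Proof. rewrite mp_measureE; exact: measure_ge0. Qed.

Let mp_sigma_additive : semi_sigma_additive marchenko_pastur.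
Proof. rewrite mp_measureE; exact: measure_semi_sigma_additive. Qed.

HB.instance Definition _ := isMeasure.Build _ _ _ marchenko_pastur
  mp0 mp_ge0 mp_sigma_additive.

End marchenko_pastur.

Definition free_poisson (R : realType) (y : R) (A : ncProbSpace R) (b : A) :
    Prop :=
  nc_selfadjoint b /\
  forall k : nat, nc_state A (b ^+ k) =
    real_complex R (\int[marchenko_pastur y]_x (x ^+ k)).

Section sample_covariance.
Context d (T : measurableType d) (R : realType).

(* Indices start at 0: [a i j] is the entry in row i+1 and column j+1. *)
Definition data_matrix (a : nat -> nat -> T -> R) (p n : nat) (t : T) :
    'M[R]_(p, n) :=
  \matrix_(i < p, j < n) a i j t.

Definition sample_covariance (a : nat -> nat -> T -> R) (p n : nat) (t : T) :
    'M[R]_p :=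
  n%:R^-1 *: (data_matrix a p n t *m (data_matrix a p n t)^T).

End sample_covariance.

(* Main.v *)
Require Import Defs.
From HB Require Import structures.
From mathcomp Require Import all_boot all_order all_algebra.
From mathcomp Require Import finmap complex.
From mathcomp Require Import all_classical all_reals all_analysis.
From mathcomp Require Import measurable_realfun.
From mathcomp Require Import zify ring lra.

Set Implicit Arguments.
Unset Strict Implicit.
Unset Printing Implicit Defensive.

Import Order.TTheory GRing.Theory Num.Theory.
Import numFieldNormedType.Exports.

Local Open Scope classical_set_scope.
Local Open Scope ring_scope.


(** The theorem holds because, to leading order, the moments of the sample
    covariance matrix count plane trees, and the correlation between a_ij and
    a_ji is never seen by a tree.

    Expanding the trace of the k-th power of X X' gives a sum over closed walks
    of 2k steps that alternate between row labels and column labels, a step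
    between row i and column j carrying the factor a_ij.  Rows and columns are
    regarded as vertices of one graph on the natural numbers, so that a_ij and
    a_ji sit on the same edge; distinct edges are then independent
    ([integral_prod_indep]).  A walk that uses some edge exactly once has mean
    zero ([integral_entry_prod_single]).  A walk with at most k vertices has a
    bounded mean, and there are too few such walks to matter
    ([count_few_vertices], [walk_sum_dfs]).  In the remaining walks every edge
    is used at least twice and k+1 vertices are visited, and this forces the walk
    to be a depth-first exploration of a tree: each step either discovers a vertex
    or goes back along the edge by which the present vertex was discovered
    ([dfs_of_repeated_edges]).  Both passages through an edge then carry the same
    variable a_ij, never a_ji, whence mean 1 ([integral_entry_prod_pairs]).

    The number of depth-first walks depends, up to lower order terms, on the
    height of the stack only, and therefore satisfies a recursion in the number
    of steps and the height ([dfs_count_bounds]).  Its normalized limit is a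
    weighted count of Dyck paths, [path_weight 1 y]: a step up to an even height
    has weight p / n, hence y in the limit
    ([sample_covariance_moments]).

    The same recursion comes from orthogonal polynomials.  After the substitution
    x = 1 + y + 2 sqrt(y) cos t, the measure x times the absolutely continuous
    part of the Marchenko-Pastur law becomes (2/pi) sin(t)^2 dt, the functions
    sin((h+1)t) / sin t are orthonormal for it, and on suitable multiples of them
    multiplication by x is the recursion of the paths seen at odd heights
    ([mp_trig_moment_path]).  This gives the moments of order at least one.  The
    total mass, in which 1/x reappears, is a limit of Poisson kernel integrals
    ([int0pi_poisson_kernel], [integral_mp_density]).

    Convergence of the moments gives the first claim, with the polynomials over
    the complex numbers as noncommutative probability space and the variable as
    free Poisson element.  It also gives the second: the limit law has compact
    support, so the indicator of a half-line can be bounded on both sides by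
    polynomials with almost the right integral ([threshold_poly],
    [weak_cvg_of_moments]). *)

(** * Walks, edges and depth-first walks *)
Section walks.
Local Open Scope nat_scope.


(** An unordered pair, in the form of the index of the independent block that
    contains a_xv and a_vx. *)
Definition edge (x v : nat) : nat + nat * nat :=
  if x == v then inl x else inr (minn x v, maxn x v).

Definition ends (e : nat + nat * nat) : seq nat :=
  match e with inl i => [:: i] | inr ij => [:: ij.1; ij.2] end.

Lemma edgeC x v : edge x v = edge v x.
Proof. by rewrite /edge eq_sym minnC maxnC; case: eqP => // ->. Qed.

Lemma mem_ends x v z : (z \in ends (edge x v)) = (z == x) || (z == v).
Proof.
rewrite /edge; case: (eqVneq x v) => [->|xv]; first by rewrite inE orbb.
by rewrite !inE; case: (ltnP x v) => // _; rewrite orbC.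
Qed.

Lemma edge_inj x : injective (edge x).
Proof.
move=> u v uv.
have : u \in ends (edge x v) by rewrite -uv mem_ends eqxx orbT.
have : v \in ends (edge x u) by rewrite uv mem_ends eqxx orbT.
rewrite !mem_ends => hv /orP[/eqP ux|/eqP //].
by move: hv; rewrite -ux orbb => /eqP.
Qed.

Lemma ends_pairmap_edge x s e z :
  e \in pairmap edge x s -> z \in ends e -> z \in x :: s.
Proof.
elim: s x => //= v s IHs x; rewrite inE => /orP[/eqP ->|es ze].
  by rewrite mem_ends !inE => /orP[] ->; rewrite ?orbT.
by rewrite inE (IHs v) ?orbT.
Qed.

Lemma uniq_pairmap_edge x s : uniq (x :: s) -> uniq (pairmap edge x s).
Proof.
elim: s x => //= v s IHs x /andP[xvs uvs]; rewrite IHs // andbT.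
apply: contra xvs => /ends_pairmap_edge; apply.
by rewrite mem_ends eqxx.
Qed.


(** Number of distinct entries of r outside vis; the recursion lets it be compared
    step by step with the analogous count of edges. *)
Fixpoint new_vertices (vis r : seq nat) : nat :=
  if r is v :: r' then (v \notin vis) + new_vertices (v :: vis) r' else 0.

Fixpoint new_edges (E l : seq (nat + nat * nat)) : nat :=
  if l is e :: l' then (e \notin E) + new_edges (e :: E) l' else 0.

Lemma eq_new_vertices vis vis' r :
  vis =i vis' -> new_vertices vis r = new_vertices vis' r.
Proof.
elim: r vis vis' => //= v r IHr vis vis' h; rewrite h; congr (_ + _)%N.
by apply: IHr => z; rewrite !inE h.
Qed.

Lemma eq_new_edges E E' r :
  E =i E' -> new_edges E r = new_edges E' r.
Proof.
elim: r E E' => //= v r IHr vis vis' h; rewrite h; congr (_ + _)%N.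
by apply: IHr => z; rewrite !inE h.
Qed.

Lemma new_vertices_seen vis v r :
  v \in vis -> new_vertices (v :: vis) r = new_vertices vis r.
Proof.
move=> vv; apply: eq_new_vertices => z; rewrite inE.
by case: eqP => // ->; rewrite vv.
Qed.


(** A vertex can only be discovered along an edge that was never used before. *)
Lemma new_vertices_edges vis (E : seq (nat + nat * nat)) x r : x \in vis ->
  (forall e, e \in E -> {subset ends e <= vis}) ->
  (new_vertices vis r <= new_edges E (pairmap edge x r))%N.
Proof.
elim: r vis E x => //= v r IHr vis E x xvis Evis; apply: leq_add.
  case: (boolP (v \in vis)) => //= vvis.
  rewrite (_ : edge x v \notin E) //; apply: contra vvis => /Evis; apply.
  by rewrite mem_ends eqxx orbT.
apply: IHr; first exact: mem_head.
move=> e; rewrite inE => /orP[/eqP ->|/Evis eE] z.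
  by rewrite mem_ends inE => /orP[/eqP ->|->] //; rewrite xvis orbT.
by move=> /eE; rewrite inE orbC => ->.
Qed.


(** Here E is the set of edges used so far and O the set of those used exactly
    once.  What remains of the walk must pay two steps for every edge outside E
    and one for every edge of O. *)
Lemma size_ge_new_edges (E O l : seq (nat + nat * nat)) :
  uniq O -> {subset O <= E} -> {subset O <= l} ->
  (forall e, e \in l -> e \notin E -> (1 < count_mem e l)%N) ->
  (2 * new_edges E l + size O <= size l)%N.
Proof.
elim: l E O => [|e l IHl] E O uO OE Ol l2 /=.
  by case: O Ol {uO OE} => // o O /(_ o (mem_head _ _)).
have cons2 E' : {subset E <= E'} -> e \in E' ->
    forall f, f \in l -> f \notin E' -> (1 < count_mem f l)%N.
  move=> EE' eE' f fl fE'; have fe : f != e.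
    by apply: contraNneq fE' => ->.
  have := l2 f _ (contra (EE' f) fE'); rewrite /= eq_sym (negPf fe) add0n.
  by apply; rewrite inE fl orbT.
case: (boolP (e \in E)) => eE /=.
  rewrite add0n (@eq_new_edges _ E); last first.
    by move=> f; rewrite inE; case: eqP => // ->.
  case: (boolP (e \in O)) => eO.
    have := IHl E (rem e O) (rem_uniq _ uO).
    rewrite size_rem // => H.
    have {H} : 2 * new_edges E l + (size O).-1 <= size l.
      apply: H => //.
      - by move=> f /mem_rem/OE.
      - move=> f; rewrite mem_rem_uniq // inE => /andP[/= fe /Ol].
        by rewrite inE (negPf fe).
      - exact: cons2.
    by case: (O) eO => //= o O' _; rewrite addnS ltnS.
  apply: leqW; apply: IHl => //.
    move=> f fO; have := Ol f fO; rewrite inE => /orP[/eqP fe|//].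
    by rewrite -fe fO in eO.
  exact: cons2.
have eO : e \notin O by apply: contra eE => /OE.
have : 2 * new_edges (e :: E) l + size (e :: O) <= size l.
  apply: IHl.
  - by rewrite /= eO.
  - by move=> f; rewrite !inE => /orP[->//|/OE ->]; rewrite orbT.
  - move=> f; rewrite inE => /orP[/eqP ->|fO].
      have := l2 e (mem_head _ _) eE; rewrite /= eqxx add1n ltnS.
      by rewrite -has_count has_pred1.
    have := Ol f fO; rewrite inE => /orP[/eqP fe|//].
    by rewrite -fe fO in eO.
  - by apply: cons2; [move=> f fE; rewrite inE fE orbT | exact: mem_head].
by rewrite /=; lia.
Qed.


(** Depth-first walks: x is the present vertex, s the stack of its ancestors, vis
    the set of visited vertices and r the list of vertices still to be visited.
    The walk must end at the root, which is the meaning of [nilp s]. *)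
Fixpoint dfs (vis : seq nat) (x : nat) (s r : seq nat) : bool :=
  if r is v :: r' then
    if v \notin vis then dfs (v :: vis) v (x :: s) r'
    else if s is u :: s' then (v == u) && dfs vis u s' r' else false
  else nilp s.


(** The edges used exactly once so far are those of the stack, and the last
    hypothesis leaves no slack in [size_ge_new_edges].  Discovering a vertex keeps
    the balance, and so does going back along a stack edge, which can only be the
    top one because the vertices of the stack are distinct.  Any other step spends
    a unit of length without progress, which the balance forbids. *)
Lemma dfs_of_repeated_edges r vis x s (E : seq (nat + nat * nat)) :
  uniq (x :: s) -> {subset x :: s <= vis} ->
  {subset pairmap edge x s <= E} ->
  (forall e, e \in E -> {subset ends e <= vis}) ->
  {subset pairmap edge x s <= pairmap edge x r} ->
  (forall e, e \in pairmap edge x r -> e \notin E ->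
     (1 < count_mem e (pairmap edge x r))%N) ->
  (size r <= 2 * new_vertices vis r + size s)%N ->
  dfs vis x s r.
Proof.
elim: r vis x s E => [|v r IHr] vis x s E us svis sE Evis sr r2 szr.
  by case: s {us svis sE szr} sr => // u s /(_ _ (mem_head _ _)).
rewrite [dfs _ _ _ _]/=; have xvis : x \in vis by apply: svis; exact: mem_head.
have Evis' : forall e, e \in edge x v :: E -> {subset ends e <= v :: vis}.
  move=> e; rewrite inE => /orP[/eqP ->|/Evis eE] z.
    by rewrite mem_ends inE => /orP[/eqP ->|->//]; rewrite xvis orbT.
  by move=> /eE; rewrite inE orbC => ->.
have r2' : forall e, e \in pairmap edge v r -> e \notin edge x v :: E ->
    (1 < count_mem e (pairmap edge v r))%N.
  move=> e er; rewrite inE negb_or => /andP[ne eE].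
  have := r2 e _ eE; rewrite /= inE er orbT eq_sym (negPf ne) add0n.
  exact.
case: (boolP (v \in vis)) => /= vvis; last first.
  have eE : edge x v \notin E.
    by apply: contra vvis => /Evis; apply; rewrite mem_ends eqxx orbT.
  apply: (IHr _ _ _ (edge x v :: E)) => //.
  - by move: us => /= ->; rewrite andbT; apply: contra vvis => /svis.
  - by move=> z; rewrite inE => /orP[/eqP ->|/svis zv];
      rewrite inE ?eqxx // zv orbT.
  - move=> e /=; rewrite inE edgeC => /orP[/eqP ->|/sE eE'].
      exact: mem_head.
    by rewrite inE eE' orbT.
  - move=> e /=; rewrite inE => /orP[/eqP ->|es].
      have := r2 (edge x v); rewrite /= mem_head edgeC eqxx add1n ltnS.
      by rewrite -has_count has_pred1 edgeC; apply.
    have := sr e es; rewrite /= inE => /orP[/eqP ee|//].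
    by move: (sE _ es); rewrite ee (negPf eE).
  - by move: szr; rewrite /= vvis /=; lia.
case: (boolP (edge x v \in pairmap edge x s)) => eO.
  case: s us svis sE sr szr eO => // u s us svis sE sr szr eO.
  have vu : v = u.
    move: eO; rewrite /= inE => /orP[/eqP/edge_inj //|].
    move=> /ends_pairmap_edge => /(_ x); rewrite mem_ends eqxx => /(_ isT) xs.
    by move: us; rewrite /= xs.
  rewrite vu in szr sr Evis' r2' vvis *; rewrite eqxx /=.
  have eE : edge x u \in E by apply: sE; exact: mem_head.
  apply: (IHr vis u s E) => //.
  - by move: us => /= /andP[].
  - by move=> z zs; apply: svis; rewrite inE zs orbT.
  - by move=> e es; apply: sE; rewrite /= inE es orbT.
  - move=> e es; have := sr e; rewrite /= !inE es orbT => /(_ isT)/orP[|//].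
    move=> /eqP ee; move: us => /uniq_pairmap_edge /=.
    by rewrite -ee es.
  - move=> e er eE'; apply: r2' => //; rewrite inE negb_or eE' andbT.
    by apply: contraNneq eE' => ->.
  - by move: szr; rewrite /= vvis /= new_vertices_seen //; lia.

(* The step neither discovers a vertex nor closes a stack edge: what remains is
   too short. *)
exfalso.
have := @size_ge_new_edges (edge x v :: E) (pairmap edge x s) (pairmap edge v r).
have := @new_vertices_edges (v :: vis) (edge x v :: E) v r (mem_head _ _) Evis'.
rewrite !size_pairmap => H1 /(_ (uniq_pairmap_edge us)) H2.
have : 2 * new_edges (edge x v :: E) (pairmap edge v r) + size s <= size r.
  apply: H2 => //.
  - by move=> e /sE eE; rewrite inE eE orbT.
  - move=> e es; have := sr e es; rewrite /= inE => /orP[/eqP ee|//].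
    by rewrite ee (negPf eO) in es.
by move: szr; rewrite /= vvis /=; lia.
Qed.


(** The index of the matrix entry on a step from x to v; b tells whether x is a
    row label. *)
Definition letter (b : bool) (x v : nat) : nat * nat :=
  if b then (x, v) else (v, x).

Fixpoint letters (b : bool) (x : nat) (r : seq nat) : seq (nat * nat) :=
  if r is v :: r' then letter b x v :: letters (~~ b) v r' else [::].

Definition letter_edge (l : nat * nat) := edge l.1 l.2.

Lemma letter_edge_letter b x v : letter_edge (letter b x v) = edge x v.
Proof. by case: b => //=; rewrite edgeC. Qed.

Lemma map_edge_letters b x r :
  map letter_edge (letters b x r) = pairmap edge x r.
Proof. by elim: r b x => //= v r IHr b x; rewrite letter_edge_letter IHr. Qed.

Lemma size_letters b x r : size (letters b x r) = size r.
Proof. by elim: r b x => //= v r IHr b x; rewrite IHr. Qed.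


(** An edge is closed at the opposite parity and in the opposite direction, so
    both passages give the same entry: no a_ji is ever paired with an a_ij.  The
    letters of the stack occur in the statement because they still await their
    second passage. *)
Lemma dfs_letters b r vis x s : dfs vis x s r -> {subset x :: s <= vis} ->
  exists L : seq (nat * nat),
    [/\ perm_eq (letters b x r) (letters b x s ++ (L ++ L)),
        uniq (map letter_edge L) &
        forall l, l \in L -> exists2 z, z \in ends (letter_edge l) & z \notin vis].
Proof.
elim: r b vis x s => [|v r IHr] b vis x s.
  by move=> /nilP -> _; exists [::]; split.
rewrite [dfs _ _ _ _]/=; case: (boolP (v \in vis)) => /= vvis; last first.
  move=> Hr svis; have svis' : {subset v :: x :: s <= v :: vis}.
    by move=> z; rewrite inE => /orP[/eqP ->|/svis zv];
      rewrite inE ?eqxx // zv orbT.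
  have [L [pL uL newL]] := IHr (~~ b) _ _ _ Hr svis'.
  exists (letter b x v :: L); split.

  (* Traversed backwards from the other kind of label, the edge has the same
     letter. *)
  - have swap : letter (~~ b) v x = letter b x v by case: (b).
    move: pL; rewrite /= swap negbK => pL.
    rewrite -(perm_cons (letter b x v)) in pL.
    apply: (perm_trans pL).
    by apply/permP => q; rewrite /= !count_cat /= !count_cat /=; lia.
  - rewrite /= uL andbT; apply/negP => /mapP[l /newL[z zl zv] e].
    move: zl zv; rewrite -e letter_edge_letter mem_ends inE.
    move=> /orP[/eqP ->|->//]; rewrite svis ?orbT //; exact: mem_head.
  - move=> l; rewrite inE => /orP[/eqP ->|/newL[z zl]].
      by exists v => //; rewrite letter_edge_letter mem_ends eqxx orbT.
    by rewrite inE negb_or => /andP[_ zv]; exists z.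
case: s => // u s /andP[/eqP -> Hr] svis.
have svis' : {subset u :: s <= vis}.
  by move=> z zs; apply: svis; rewrite inE zs orbT.
have [L [pL uL newL]] := IHr (~~ b) _ _ _ Hr svis'.
by exists L; split => //=; rewrite perm_cons.
Qed.

Lemma dfs_last vis x s r : dfs vis x s r -> last x r = last x s.
Proof.
elim: r vis x s => [|v r IHr] vis x s /=; first by move/nilP ->.
case: ifP => _; first by move/IHr => ->.
by case: s => // u s /andP[/eqP -> /IHr].
Qed.


(** * Counting walks *)

(** The continuations, in t steps, of a walk that stands at a row label if b and
    at a column label otherwise; row labels are below p, column labels below n. *)
Fixpoint walks (n p : nat) (b : bool) (t : nat) : seq (seq nat) :=
  if t is t'.+1 then
    [seq v :: r | v <- index_iota 0 (if b then n else p), r <- walks n p (~~ b) t']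
  else [:: [::]].

Lemma mem_walks_size n p b t r : r \in walks n p b t -> size r = t.
Proof.
elim: t b r => [|t IHt] b r /=; first by rewrite inE => /eqP ->.
by move=> /allpairsP[[v r'] /= [_ /IHt sr' ->]] /=; rewrite sr'.
Qed.

Lemma count_walksS n p b t (P : pred (seq nat)) :
  count P (walks n p b t.+1) =
  (\sum_(0 <= v < if b then n else p)
     count (fun r => P (v :: r)) (walks n p (~~ b) t))%N.
Proof.
rewrite /= count_flatten sumnE !big_map; apply: eq_bigr => v _.
by rewrite count_map.
Qed.

Lemma count_mem_iota_le (vis : seq nat) m :
  (count [in vis] (index_iota 0 m) <= size vis)%N.
Proof.
rewrite -size_filter; apply: uniq_leq_size; first by rewrite filter_uniq // iota_uniq.
by move=> v; rewrite mem_filter => /andP[].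
Qed.


(** Each step either repeats one of at most K vertices or uses up one of the j
    allowed discoveries, for which there are at most N labels. *)
Lemma count_few_vertices n p N K b t vis j :
  (0 < N)%N -> (n <= N)%N -> (p <= N)%N -> (size vis + t <= K)%N ->
  (count (fun r => new_vertices vis r <= j)%N (walks n p b t)
     <= K.+1 ^ t * N ^ j)%N.
Proof.
move=> N0 nN pN; elim: t b vis j => [|t IHt] b vis j K_ge.
  by rewrite /= mul1n addn0 expn_gt0 N0.
rewrite count_walksS; set m := if b then n else p.
have mN : (m <= N)%N by rewrite /m; case: (b).
pose B i := (K.+1 ^ t * N ^ i)%N.
have step v : (count (fun r => new_vertices vis (v :: r) <= j)%N
    (walks n p (~~ b) t) <= (v \in vis) * B j + (0 < j) * B j.-1)%N.
  rewrite /=; case: (boolP (v \in vis)) => vvis /=.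
    rewrite mul1n; apply: leq_trans (leq_addr _ _).
    rewrite (@eq_count _ _ (fun r => new_vertices vis r <= j)%N); last first.
      by move=> r /=; rewrite new_vertices_seen.
    by apply: IHt; lia.
  rewrite mul0n add0n; case: j => [|j] /=.
    by rewrite (@eq_count _ _ pred0) ?count_pred0 // => r; lia.
  rewrite mul1n (@eq_count _ _ (fun r => new_vertices (v :: vis) r <= j)%N).
    by apply: IHt => /=; lia.
  by move=> r /=; lia.
apply: leq_trans (leq_sum _ (fun v _ => step v)) _.
rewrite big_split /= -big_distrl /= sum_nat_const_nat subn0.
have -> : (\sum_(0 <= v < m) (v \in vis) = count [in vis] (index_iota 0 m))%N.
  by rewrite -sum1_count [RHS]big_mkcond; apply: eq_bigr => v _; case: (v \in vis).
have h1 : (count [in vis] (index_iota 0 m) * B j <= K * B j)%N.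
  by rewrite leq_mul2r (leq_trans (count_mem_iota_le _ _)) ?orbT //; lia.
have h2 : (m * ((0 < j) * B j.-1) <= B j)%N.
  case: j @B step h1 => [|j] B step h1 /=; first by rewrite mul0n muln0.
  by rewrite mul1n /B expnS mulnCA leq_mul2l leq_mul ?orbT.
apply: leq_trans (leq_add h1 h2) _.
by rewrite /B expnS; lia.
Qed.


(** Weighted count of the nonnegative lattice paths from height h to 0 in t steps,
    the weights of the steps up alternating with the parity of time.  The values
    lie in a semiring in order to be both natural and real numbers. *)
Fixpoint path_weight (S : pzSemiRingType) (c w : S) (b : bool) (t h : nat) : S :=
  if t is t'.+1 then
    ((if b then c else w) * path_weight c w (~~ b) t' h.+1
     + (if h is h'.+1 then path_weight c w (~~ b) t' h' else 0))%R
  else ((h == 0%N)%:R)%R.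

Fixpoint alternating (n p : nat) (b : bool) (s : seq nat) : bool :=
  if s is u :: s' then (u < if b then n else p)%N && alternating n p (~~ b) s'
  else true.

Definition dfs_count n p b t vis x s :=
  count (dfs vis x s) (walks n p b t).

Lemma dfs_countS n p b t vis x s : {subset x :: s <= vis} -> alternating n p b s ->
  dfs_count n p b t.+1 vis x s =
  (\sum_(0 <= v < if b then n else p | v \notin vis)
     dfs_count n p (~~ b) t (v :: vis) v (x :: s)
   + if s is u :: s' then dfs_count n p (~~ b) t vis u s' else 0)%N.
Proof.
move=> svis alt; rewrite /dfs_count count_walksS.
set m := if b then n else p.
rewrite (bigID [in vis]) /= addnC; congr (_ + _)%N.
  by apply: eq_bigr => v vvis; rewrite vvis.
case: s svis alt => [|u s] svis alt.
  rewrite big1 // => v ->.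
  by rewrite (@eq_count _ _ pred0) ?count_pred0.
have uvis : u \in vis by apply: svis; rewrite !inE eqxx orbT.
have um : (u < m)%N by move: alt => /= /andP[].
rewrite big_mkcond (bigD1_seq u) ?iota_uniq ?mem_index_iota //= uvis.
rewrite big1 ?addn0 //=; last first.
  move=> v vu; case: (boolP (v \in vis)) => //= vvis.
  by rewrite (negPf vu) (@eq_count _ _ pred0) ?count_pred0.
by apply: eq_count => r; rewrite eqxx.
Qed.


(** The size of the stack is the height of the path.  Going back leaves no choice;
    a discovery has as many choices as there are unvisited labels of the right
    kind, that is, all of them but at most K. *)
Lemma dfs_count_bounds n p K b t vis x s :
  (size vis + t <= K)%N -> {subset x :: s <= vis} -> alternating n p b s ->
  (x < if b then p else n)%N ->
  (@path_weight nat (n - K)%N (p - K)%N b t (size s) <= dfs_count n p b t vis x s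
     <= @path_weight nat n p b t (size s))%N.
Proof.
elim: t b vis x s => [|t IHt] b vis x s K_ge svis alt xm.
  rewrite /dfs_count /= addn0 -/(nilp s).
  by case: (nilp s) => /=.
rewrite dfs_countS // [path_weight (n - K)%N _ _ _ _]/= [path_weight n _ _ _ _]/=.
set m := if b then n else p.
have -> : (if b then (n - K)%N else (p - K)%N) = (m - K)%N by rewrite /m; case: (b).
have popP : ((if size s is h'.+1 then @path_weight nat (n - K)%N (p - K)%N (~~ b) t h' else 0%R)
    <= (if s is u :: s' then dfs_count n p (~~ b) t vis u s' else 0)
    <= (if size s is h'.+1 then @path_weight nat n p (~~ b) t h' else 0%R))%N.
  case: s svis alt => //= u s svis /andP[um alt]; apply: IHt => //.
  - by lia.
  - by move=> z zs; apply: svis; rewrite inE zs orbT.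
  - by case: (b) um.
have pushP v : (v < m)%N -> v \notin vis ->
    (@path_weight nat (n - K)%N (p - K)%N (~~ b) t (size s).+1
     <= dfs_count n p (~~ b) t (v :: vis) v (x :: s)
     <= @path_weight nat n p (~~ b) t (size s).+1)%N.
  move=> vm vvis; apply: (IHt (~~ b) (v :: vis) v (x :: s)) => /=.
  - by rewrite addSnnS.
  - by move=> z; rewrite inE => /orP[/eqP ->|/svis zv];
      rewrite inE ?eqxx // zv orbT.
  - by rewrite negbK alt andbT; case: (b) xm.
  - by move: vm; rewrite /m; case: (b).
move: popP pushP; set A := path_weight (n - K)%N _ _ _ _.
set A' := path_weight n p _ _ _; move=> /andP[pop1 pop2] pushP.
have fresh_ge : (m - K <= count [predC vis] (index_iota 0 m))%N.
  have H := count_predC [in vis] (index_iota 0 m).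
  rewrite -[X in (X - _)%N]subn0 -(size_iota 0 (m - 0)) -/(index_iota 0 m) -H.
  rewrite leq_subLR leq_add2r (leq_trans (count_mem_iota_le _ _)) //.
  exact: leq_trans (leq_addr _ _) K_ge.
apply/andP; split; apply: leq_add => //.
  apply: (@leq_trans (\sum_(0 <= v < m | v \notin vis) A)%N).
    by rewrite big_const_seq iter_addn_0 mulnC leq_mul2r fresh_ge orbT.
  rewrite big_seq_cond [leqRHS]big_seq_cond; apply: leq_sum => v.
  by rewrite mem_index_iota => /andP[/= vm vv]; case/andP: (pushP v vm vv).
apply: (@leq_trans (\sum_(0 <= v < m | v \notin vis) A')%N).
  rewrite big_seq_cond [leqRHS]big_seq_cond; apply: leq_sum => v.
  by rewrite mem_index_iota => /andP[/= vm vv]; case/andP: (pushP v vm vv).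
rewrite big_const_seq iter_addn_0 mulnC leq_mul2r.
by rewrite (leq_trans (count_size _ _)) ?size_iota ?subn0 // orbT.
Qed.
End walks.


(** * Traces of powers as sums over walks *)
Section matrix_walks.
Variables (R : comNzRingType) (A : nat -> nat -> R) (n p : nat).

Let X : 'M[R]_(p, n) := \matrix_(i < p, j < n) A i j.

Definition walk_prod (l : seq (nat * nat)) : R := \prod_(e <- l) A e.1 e.2.

Lemma gram_exp_walks k (i j : 'I_p) :
  ((X *m X^T) ^+ k) i j =
  \sum_(r <- walks n p true k.*2 | last (i : nat) r == j)
     walk_prod (letters true i r).
Proof.
elim: k i => [|k IHk] i.
  rewrite expr0 big_mkcond /= big_seq1 /= mxE /walk_prod big_nil val_eqE.
  by case: eqP.
have sumW (F : seq nat -> R) b m : \sum_(r <- walks n p b m.+1) F r =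
    \sum_(v < if b then n else p) \sum_(r <- walks n p (~~ b) m) F (val v :: r).
  rewrite /= big_allpairs_dep big_mkord; apply: eq_bigr => v _ //.
rewrite exprS -mulmxE mxE doubleS [RHS]big_mkcond sumW.
under eq_bigr => l _ do rewrite mxE big_distrl /=.
rewrite exchange_big; apply: eq_bigr => v _.
rewrite sumW; apply: eq_bigr => l _.
rewrite !mxE IHk big_distrr [LHS]big_mkcond /=; apply: eq_bigr => r _.
case: eqP => // _.
by rewrite /walk_prod /= !big_cons /= mulrA.
Qed.

Lemma scale_exp_mx (c : R) (M : 'M[R]_p) k : (c *: M) ^+ k = c ^+ k *: M ^+ k.
Proof.
elim: k => [|k IHk]; first by rewrite !expr0 scale1r.
by rewrite !exprS IHk -!mulmxE -scalemxAl -scalemxAr scalerA.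
Qed.

Lemma trace_scaled_gram_exp (c : R) k :
  \tr ((c *: (X *m X^T)) ^+ k) =
  c ^+ k * \sum_(0 <= v < p)
    \sum_(r <- walks n p true k.*2 | last v r == v) walk_prod (letters true v r).
Proof.
rewrite scale_exp_mx mxtraceZ; congr (_ * _); rewrite big_mkord.
by apply: eq_bigr => i _; rewrite gram_exp_walks.
Qed.

End matrix_walks.

Section path_weights.

Lemma path_weight_natr (S : pzSemiRingType) (c w : nat) b t h :
  (@path_weight nat c w b t h)%:R = path_weight (c%:R : S) w%:R b t h.
Proof.
elim: t b h => [|t IHt] b h /=; first by case: h.
rewrite natrD natrM IHt; congr (_ * _ + _); first by case: b.
by case: h => [|h] //; exact: IHt.
Qed.

Lemma path_weight_eq0 (S : pzSemiRingType) (c w : S) b t h : (t < h)%N ->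
  path_weight c w b t h = 0.
Proof.
elim: t b h => [|t IHt] b [|h] //= th.
by rewrite !IHt ?mulr0 ?addr0 // ltnW // ltnS ltnW.
Qed.


(** A path from height h to 0 in 2m + h steps has m steps up. *)
Lemma path_weight_scale (S : comPzSemiRingType) (s c w : S) b t h m :
  (m.*2 + h)%N = t -> path_weight (s * c) (s * w) b t h = s ^+ m * path_weight c w b t h.
Proof.
elim: t b h m => [|t IHt] b h m.
  by case: m => //= _; rewrite expr0 mul1r.
case: h m => [|h] [|m] //= ht.
- rewrite !addr0 (IHt _ _ m) ?exprS; last by lia.
  by case: b {IHt}; rewrite mulrACA.
- have th : (t < h.+2)%N by lia.
  rewrite !(path_weight_eq0 _ _ _ th).
  by rewrite !mulr0 !add0r (IHt _ _ 0) //; lia.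
- rewrite (IHt _ _ m); last by lia.
  rewrite (IHt _ _ m.+1); last by lia.
  rewrite mulrDr exprS; congr (_ + _).
  by case: b {IHt}; rewrite mulrACA.
Qed.

Lemma cvg_path_weight (R : realType) (c w : nat -> R) (c0 w0 : R) b t h :
  c i @[i --> \oo] --> c0 -> w i @[i --> \oo] --> w0 ->
  path_weight (c i) (w i) b t h @[i --> \oo] --> path_weight c0 w0 b t h.
Proof.
move=> cc cw; elim: t b h => [|t IHt] b h; first exact: cvg_cst.
have IHh h' : (match h' with 0 => 0 | h'.+1 => path_weight (c i) (w i) (~~ b) t h' end)
    @[i --> \oo] --> (match h' with 0 => 0 | h'.+1 => path_weight c0 w0 (~~ b) t h' end).
  by case: h' => [|h']; [exact: cvg_cst|exact: IHt].
apply: cvgD; last exact: IHh.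
by apply: cvgM; [case: b {IHt IHh}|exact: IHt].
Qed.

End path_weights.


(** * Expectations of products of independent variables *)
Section integral_density.
Context d d' (T : measurableType d) (T' : measurableType d') (R : realType).
Variables (m : {measure set T -> \bar R}) (m' : {measure set T' -> \bar R}).
Import HBNNSimple.


(** Both sides are integrals of the identity against the law of Z under Y m and
    the law of Z' under m', and these laws agree.  The case Z' = Z with m' a multiple of m
    is independence; the case where Y is a density is a change of measure.  Two
    carriers T and T' are needed because the same set may bear two measurable
    structures. *)
Lemma ge0_integral_density (Z Y : T -> R) (Z' : T' -> R) :
  measurable_fun setT Z -> measurable_fun setT Y -> measurable_fun setT Z' ->
  (forall t, 0 <= Z t) -> (forall t, 0 <= Z' t) -> (forall t, 0 <= Y t) ->
  (forall B, measurable B ->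
     \int[m]_(t in Z @^-1` B) (Y t)%:E = m' (Z' @^-1` B))%E ->
  (\int[m]_t (Z t * Y t)%:E = \int[m']_t (Z' t)%:E)%E.
Proof.
move=> mZ mY mZ' Z0 Z0' Y0 ZY.
have mabs : measurable_fun [set: R] (fun x : R => (`|x|)%:E).
  by apply/measurable_EFinP; exact: normr_measurable.
pose g := nnsfun_approx measurableT mabs.
have mg n : measurable_fun setT (g n) by [].
have nd_g x m1 n : (m1 <= n)%N -> g m1 x <= g n x.
  by move=> mn; have /lefP := nd_nnsfun_approx measurableT mabs mn; exact.
have cvg_g x : 0 <= x -> (g n x)%:E @[n --> \oo] --> x%:E.
  move=> x0; have /= := @cvg_nnsfun_approx _ _ _ _ measurableT _ mabs
    (fun x _ => normr_ge0 x) x I.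
  by rewrite ger0_norm.
have mgZ n : measurable_fun setT (fun t => g n (Z t)) by exact: measurableT_comp.
have mgZ' n : measurable_fun setT (fun t => g n (Z' t)) by exact: measurableT_comp.
have simple n : (\int[m]_t (g n (Z t) * Y t)%:E = \int[m']_t (g n (Z' t))%:E)%E.
  pose s := fset_set (range (g n)).
  pose A (r : R) : set R := g n @^-1` [set r].
  have mA r : measurable (A r) by exact: measurable_funPTI.
  have mZA r : measurable (Z @^-1` A r) by rewrite -[X in measurable X]setTI; exact: mZ.
  have mZA' r : measurable (Z' @^-1` A r) by rewrite -[X in measurable X]setTI; exact: mZ'.
  (* g n takes nonnegative values only; writing |r| for r makes every summand
     nonnegative, whether or not r is a value of g n. *)
  have gE x : g n x = \sum_(r <- s) `|r| * \1_(A r) x.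
    rewrite fimfunE fsbig_finite//=; apply: eq_bigr => r _.
    rewrite !indicE /A /=; case: (pselect (g n x = r)) => gr.
      by rewrite -gr ger0_norm.
    by rewrite !memNset ?mulr0.
  have m1 r : measurable_fun setT (fun t => \1_(A r) (Z t) : R).
    by have := @measurable_indic _ _ R setT _ (mZA r).
  have m1' r : measurable_fun setT (fun t => \1_(A r) (Z' t) : R).
    by have := @measurable_indic _ _ R setT _ (mZA' r).
  under eq_integral do rewrite gE mulr_suml -sumEFin.
  under [RHS]eq_integral do rewrite gE -sumEFin.
  rewrite !ge0_integral_sum//; first last.
  - by move=> r t _; rewrite lee_fin !mulr_ge0.
  - by move=> r; apply/measurable_EFinP; do 2 apply: measurable_funM => //.
  - by move=> r; apply/measurable_EFinP; apply: measurable_funM.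
  apply: eq_bigr => r _.
  under eq_integral do rewrite -mulrA EFinM.
  under [RHS]eq_integral do rewrite EFinM.
  rewrite !ge0_integralZl_EFin//; first last.
  - by apply/measurable_EFinP; apply: measurable_funM.
  - by move=> t _; rewrite lee_fin mulr_ge0.
  - exact/measurable_EFinP.
  congr (_ * _)%E; rewrite (integral_indic _ measurableT (mZA' r)) setIT -[RHS]ZY// [RHS]integral_mkcond.
  apply: eq_integral => t _; rewrite /patch indicE.
  have -> : (t \in Z @^-1` A r) = (Z t \in A r) by apply/idP/idP; rewrite !inE.
  by case: ifP => _; rewrite ?mul1r ?mul0r.
have cvg1 : (\int[m]_t (g n (Z t) * Y t)%:E)%E @[n --> \oo] -->
    (\int[m]_t (Z t * Y t)%:E)%E.
  rewrite (_ : (fun t => (Z t * Y t)%:E) =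
               (fun t => limn (fun n => (g n (Z t) * Y t)%:E))); last first.
    apply/funext => t; apply/esym/cvg_lim => //.
    under eq_fun do rewrite EFinM; rewrite EFinM.
    by apply: cvgeZr => //; exact: cvg_g.
  apply: cvg_monotone_convergence => //.
  - by move=> n; apply/measurable_EFinP/measurable_funM.
  - by move=> n t _; rewrite lee_fin mulr_ge0.
  - by move=> t _ m1 n mn; rewrite lee_fin ler_wpM2r// nd_g.
have cvg2 : (\int[m']_t (g n (Z' t))%:E)%E @[n --> \oo] --> (\int[m']_t (Z' t)%:E)%E.
  rewrite (_ : (fun t => (Z' t)%:E) = (fun t => limn (fun n => (g n (Z' t))%:E))).
    apply: cvg_monotone_convergence => //.
    - by move=> n; apply/measurable_EFinP.
    - by move=> n t _; rewrite lee_fin.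
    - by move=> t _ m1 n mn; rewrite lee_fin nd_g.
  by apply/funext => t; apply/esym/cvg_lim => //; exact: cvg_g.
by move: cvg1; rewrite (funext simple) => /cvg_unique; apply.
Qed.

End integral_density.

Lemma ge0_integral_indepM d (T : measurableType d) (R : realType)
    (P : {measure set T -> \bar R}) (Z Y : T -> R) :
  measurable_fun setT Z -> measurable_fun setT Y ->
  (forall t, 0 <= Z t) -> (forall t, 0 <= Y t) ->
  (\int[P]_t (Y t)%:E \is a fin_num)%E ->
  (forall B, measurable B -> \int[P]_t (\1_(Z @^-1` B) t * Y t)%:E =
     P (Z @^-1` B) * \int[P]_t (Y t)%:E)%E ->
  (\int[P]_t (Z t * Y t)%:E = \int[P]_t (Z t)%:E * \int[P]_t (Y t)%:E)%E.
Proof.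
move=> mZ mY Z0 Y0 finY ZY.
have EY0 : (0 <= \int[P]_t (Y t)%:E)%E by apply: integral_ge0 => t _; rewrite lee_fin.
pose c := NngNum (fine_ge0 EY0).
rewrite (@ge0_integral_density _ _ _ _ _ P (mscale c P) _ _ Z) // => [|B mB].
  rewrite ge0_integral_mscale //; first last.
  - by move=> t _; rewrite lee_fin.
  - exact/measurable_EFinP.
  by rewrite /= fineK // muleC.
transitivity (P (Z @^-1` B) * \int[P]_t (Y t)%:E)%E; last first.
  by rewrite -[(\int[P]_t _)%E]fineK // muleC.
rewrite -ZY // integral_mkcond.
apply: eq_integral => t _; rewrite /patch indicE.
by case: ifP => _; rewrite ?mul1r ?mul0r.
Qed.

Section independent_product.
Context d (T : measurableType d) (R : realType) (P : probability T R).
Context (I : choiceType) (D : set I) (G : I -> set (set T)).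
Hypothesis G_indep : mutually_independent P D G.

Definition adapted (Z : I -> T -> R) (b : I) :=
  measurable_fun setT (Z b) /\ (forall B, measurable B -> G b (Z b @^-1` B)).

Hypothesis G_measurable : forall b A, G b A -> measurable A.

Let prodZ (J : seq I) (Z : I -> T -> R) t := \prod_(b <- J) Z b t.

Let measurable_prodZ J Z : (forall b, b \in J -> measurable_fun setT (Z b)) ->
  measurable_fun setT (prodZ J Z).
Proof. by move=> mZ; apply: measurable_prod. Qed.


Lemma prod_indicE (s : seq I) (A : I -> set T) t :
  \prod_(b <- s) \1_(A b) t = \1_(\bigcap_(b in [set` s]) A b) t :> R.
Proof.
elim: s => [|b s IHs]; first by rewrite big_nil indicE mem_set // => b.
rewrite big_cons IHs !indicE -natrM mulnb; congr (_%:R); congr nat_of_bool.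
rewrite -in_setI; congr (_ \in _); apply/seteqP; split => [u [Ab As] c /=|u As].
  by rewrite inE => /orP[/eqP ->//|]; exact: As.
split; first by apply: As => /=; rewrite mem_head.
by move=> c cs; apply: As => /=; rewrite inE orbC cs.
Qed.

Lemma integral_prod_indic (s : seq I) (A : I -> set T) :
  uniq s -> [set` s] `<=` D -> (forall b, b \in s -> G b (A b)) ->
  (\int[P]_t (\prod_(b <- s) \1_(A b) t)%:E = \prod_(b <- s) P (A b))%E.
Proof.
move=> us sD GA; under eq_integral do rewrite prod_indicE.
have mA : measurable (\bigcap_(b in [set` s]) A b).
  by apply: fin_bigcap_measurable => // b /GA/G_measurable.
rewrite integral_indic// setIT.
have e : perm_eq [fset x in s]%fset s.
  by apply: uniq_perm; [exact: fset_uniq | | move=> x; rewrite in_fset].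
have sE : [set` s] = [set` [fset x in s]%fset].
  by apply/seteqP; split => x /=; rewrite in_fset.
rewrite -(perm_big _ e) sE; apply: G_indep; first by rewrite -sE.
by move=> b; rewrite in_fset => /GA.
Qed.


(** Induction on the number of factors that are not indicators: when one of them
    is replaced by the indicator of one of its events, there is one fewer of
    them, and that is all [ge0_integral_indepM] asks for. *)
Lemma ge0_integral_prod_indic (s1 s2 : seq I) (Z : I -> T -> R) (A : I -> set T) :
  uniq (s1 ++ s2) -> [set` s1 ++ s2] `<=` D ->
  (forall b, b \in s1 -> adapted Z b) ->
  (forall b t, b \in s1 -> 0 <= Z b t) ->
  (forall b, b \in s1 -> (\int[P]_t (Z b t)%:E \is a fin_num)%E) ->
  (forall b, b \in s2 -> G b (A b)) ->
  (\int[P]_t ((\prod_(b <- s1) Z b t) * (\prod_(b <- s2) \1_(A b) t))%:E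
   = (\prod_(b <- s1) \int[P]_t (Z b t)%:E) * (\prod_(b <- s2) P (A b)))%E.
Proof.
elim: s1 s2 A => [|b s1 IH] s2 A us sD aZ Z0 fZ GA.
  rewrite big_nil mul1e; under eq_integral do rewrite big_nil mul1r.
  exact: integral_prod_indic.
have bs1 c : c \in s1 -> c \in b :: s1 by move=> cs; rewrite inE cs orbT.
have uss : perm_eq ((b :: s1) ++ s2) (s1 ++ b :: s2).
  by rewrite -[b :: s2]cat1s -[b :: s1]cat1s -catA perm_catCA.
have us2 : uniq (s1 ++ s2) by move: us => /= /andP[].
have bs2 : b \notin s2 by move: us; rewrite /= mem_cat negb_or => /andP[/andP[]].
have s2D : [set` s1 ++ s2] `<=` D.
  by move=> c /= cs; apply: sD => /=; rewrite inE cs orbT.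
pose Y t := (\prod_(b <- s1) Z b t) * (\prod_(b <- s2) \1_(A b) t).
have IH0 := IH s2 A us2 s2D (fun c cs => aZ c (bs1 c cs))
  (fun c t cs => Z0 c t (bs1 c cs)) (fun c cs => fZ c (bs1 c cs)) GA.
rewrite -/(Y _) in IH0.
under eq_integral do rewrite big_cons -mulrA -/(Y _).
rewrite big_cons -muleA -IH0.
have [mZb GZb] := aZ b (mem_head _ _).
have step B : measurable B -> (\int[P]_t (\1_(Z b @^-1` B) t * Y t)%:E =
     P (Z b @^-1` B) * \int[P]_t (Y t)%:E)%E.
  move=> mB; rewrite IH0.
  pose A' c := if c == b then Z b @^-1` B else A c.
  have A'b : A' b = Z b @^-1` B by rewrite /A' eqxx.
  have A's2 c : c \in s2 -> A' c = A c.
    by move=> cs; rewrite /A'; case: eqP => // cb; rewrite -cb cs in bs2.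
  have -> : (\prod_(c <- s2) P (A c) = \prod_(c <- s2) P (A' c))%E.
    by rewrite big_seq [RHS]big_seq; apply: eq_bigr => c cs; rewrite A's2.
  rewrite muleCA -A'b -(big_cons _ _ b s2 xpredT (fun c => P (A' c))) -IH.
  - apply: eq_integral => t _; rewrite big_cons mulrCA /Y; congr (_ * (_ * _))%:E.
    by rewrite big_seq [RHS]big_seq; apply: eq_bigr => c cs; rewrite A's2.
  - by rewrite -(perm_uniq uss).
  - by move=> c /=; rewrite -(perm_mem uss); exact: sD.
  - by move=> c /bs1/aZ.
  - by move=> c t /bs1/Z0.
  - by move=> c /bs1/fZ.
  - move=> c; rewrite inE => /orP[/eqP ->|cs]; first by rewrite A'b; exact: GZb.
    by rewrite A's2 //; exact: GA.
apply: ge0_integral_indepM => //.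
- apply: measurable_funM; first by apply: measurable_prodZ => c /bs1/aZ[].
  apply: (@measurable_prodZ s2 (fun c => \1_(A c))) => c /GA/G_measurable mA.
  exact: measurable_indic.
- by move=> t; apply: Z0; exact: mem_head.
- move=> t; rewrite mulr_ge0 //; last by rewrite prodr_ge0.
  by rewrite big_seq prodr_ge0 // => c /bs1/Z0.
- rewrite IH0 fin_numM // big_seq prode_fin_num // => c.
    by move=> /bs1/fZ.
  by move=> /GA/G_measurable mA; exact: fin_num_measure.
Qed.


Lemma adapted_comp (f : R -> R) Z b : measurable_fun setT f -> adapted Z b ->
  adapted (fun c t => f (Z c t)) b.
Proof.
move=> mf [mZ GZ]; split; first exact: measurableT_comp.
move=> B mB; have := GZ (f @^-1` B); apply.
by rewrite -[X in measurable X]setTI; exact: mf.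
Qed.

Lemma integrable_prod (s : seq I) (Z : I -> T -> R) :
  uniq s -> [set` s] `<=` D ->
  (forall b, b \in s -> adapted Z b) ->
  (forall b, b \in s -> P.-integrable setT (EFin \o Z b)) ->
  P.-integrable setT (fun t => (\prod_(b <- s) Z b t)%:E).
Proof.
move=> us sD aZ iZ; apply/integrableP; split.
  by apply/measurable_EFinP/measurable_prodZ => b /aZ[].
have := @ge0_integral_prod_indic s [::] (fun b t => `|Z b t|) (fun=> setT).
rewrite cats0 big_nil mule1 => H.
under eq_integral do rewrite abse_EFin normr_prod.
have fin b : b \in s -> (\int[P]_t (`|Z b t|)%:E \is a fin_num)%E.
  by move=> /iZ ibs; apply: integrable_fin_num => //; exact: integrable_norm.
have -> : (\int[P]_t (\prod_(b <- s) `|Z b t|)%:E =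
    \prod_(b <- s) \int[P]_t (`|Z b t|)%:E)%E.
  rewrite -H //; first by apply: eq_integral => t _; rewrite big_nil mulr1.
  by move=> b bs; apply: adapted_comp; [exact: normr_measurable | exact: aZ].
by rewrite ltey_eq big_seq prode_fin_num.
Qed.


(** The signs are removed one factor at a time, by splitting it into positive and
    negative parts; s2 lists the factors already known to be nonnegative. *)
Lemma integral_prod_partly_signed (s1 s2 : seq I) (Z : I -> T -> R) :
  uniq (s1 ++ s2) -> [set` s1 ++ s2] `<=` D ->
  (forall b, b \in s1 ++ s2 -> adapted Z b) ->
  (forall b, b \in s1 ++ s2 -> P.-integrable setT (EFin \o Z b)) ->
  (forall b t, b \in s2 -> 0 <= Z b t) ->
  (\int[P]_t (\prod_(b <- s1 ++ s2) Z b t)%:E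
    = \prod_(b <- s1 ++ s2) \int[P]_t (Z b t)%:E)%E.
Proof.
elim: s1 s2 Z => [|b s1 IH] s2 Z us sD aZ iZ Z0.
  rewrite cat0s in us sD aZ iZ *.
  have := @ge0_integral_prod_indic s2 [::] Z (fun=> setT).
  rewrite cats0 big_nil mule1 => H.
  rewrite -H //; first by apply: eq_integral => t _; rewrite big_nil mulr1.
  by move=> b /iZ ib; exact: integrable_fin_num.
rewrite cat_cons in us sD aZ iZ *.
have uss : perm_eq (b :: s1 ++ s2) (s1 ++ b :: s2).
  by rewrite -[b :: s2]cat1s -[b :: _]cat1s perm_catCA.
have /= /andP[bs us12] := us.
have bb : b \in b :: s1 ++ s2 by exact: mem_head.
have inb c : c \in s1 ++ s2 -> c \in b :: s1 ++ s2 by move=> cs; rewrite inE cs orbT.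
have s12D : [set` s1 ++ s2] `<=` D by move=> c /= /inb /sD.
pose W t := \prod_(c <- s1 ++ s2) Z c t.
pose EW := (\prod_(c <- s1 ++ s2) \int[P]_t (Z c t)%:E)%E.
have EWfin : (EW \is a fin_num)%E.
  by rewrite /EW big_seq prode_fin_num // => c /inb/iZ ic; exact: integrable_fin_num.
have part (f : R -> R) : measurable_fun setT f -> (forall x, 0 <= f x) ->
    P.-integrable setT (fun t => (f (Z b t))%:E) ->
  P.-integrable setT (fun t => (f (Z b t) * W t)%:E) /\
  (\int[P]_t (f (Z b t) * W t)%:E = \int[P]_t (f (Z b t))%:E * EW)%E.
  move=> mf f0 ifZ.
  pose Zf c t := if c == b then f (Z b t) else Z c t.
  have Zfb t : Zf b t = f (Z b t) by rewrite /Zf eqxx.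
  have Zfs c : c \in s1 ++ s2 -> Zf c = Z c.
    by move=> cs; apply/funext => t; rewrite /Zf; case: eqP => // cb; rewrite -cb cs in bs.
  have Zfb' : Zf b = (fun t => f (Z b t)) by apply/funext.
  have aZf c : c \in b :: s1 ++ s2 -> adapted Zf c.
    rewrite inE => /orP[/eqP ->|cs].
      have := adapted_comp mf (aZ b bb); rewrite /adapted /=.
      by rewrite Zfb'.
    by have := aZ c (inb c cs); rewrite /adapted Zfs.
  have iZf c : c \in b :: s1 ++ s2 -> P.-integrable setT (EFin \o Zf c).
    rewrite inE => /orP[/eqP ->|cs]; first by rewrite Zfb'.
    by rewrite Zfs //; exact/iZ/inb.
  have prodE t : f (Z b t) * W t = \prod_(c <- b :: s1 ++ s2) Zf c t.
    rewrite big_cons Zfb; congr (_ * _); rewrite /W big_seq [RHS]big_seq.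
    by apply: eq_bigr => c cs; rewrite Zfs.
  rewrite (_ : (fun t => _) = (fun t => (\prod_(c <- b :: s1 ++ s2) Zf c t)%:E)); last first.
    by apply/funext => t; rewrite prodE.
  split; first exact: integrable_prod.
  under eq_integral do rewrite (perm_big _ uss) /=.
  rewrite IH.
  - rewrite -(perm_big _ uss) big_cons; congr (_ * _)%E.
      by apply: eq_integral => t _; rewrite Zfb.
    rewrite /EW big_seq [RHS]big_seq; apply: eq_bigr => c cs.
    by rewrite Zfs.
  - by rewrite -(perm_uniq uss).
  - by move=> c /=; rewrite -(perm_mem uss); exact: sD.
  - by move=> c; rewrite -(perm_mem uss); exact: aZf.
  - by move=> c; rewrite -(perm_mem uss); exact: iZf.
  - move=> c t; rewrite inE => /orP[/eqP ->|cs]; first by rewrite Zfb.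
    by rewrite Zfs ?Z0 // mem_cat cs orbT.
have mb : measurable_fun setT (Z b) by case: (aZ b bb).
have mid : measurable_fun setT (fun x : R => x) by exact: measurable_id.
have mp : measurable_fun setT (fun x : R => Num.max x 0).
  exact: measurable_maxr.
have mn : measurable_fun setT (fun x : R => Num.max (- x) 0).
  by apply: measurable_maxr => //; exact: measurableT_comp.
have ip : P.-integrable setT (fun t => (Num.max (Z b t) 0)%:E).
  by have := integrable_funrpos measurableT (iZ b bb).
have in_ : P.-integrable setT (fun t => (Num.max (- Z b t) 0)%:E).
  by have := integrable_funrneg measurableT (iZ b bb).
have [ipW EpW] := part _ mp (fun x => ltac:(by rewrite le_max lexx orbT)) ip.
have [inW EnW] := part _ mn (fun x => ltac:(by rewrite le_max lexx orbT)) in_.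
have splitmax x : x = Num.max x 0 - Num.max (- x) 0 :> R.
  by case: (leP x 0) => x0; case: (leP (- x) 0) => x0'; lra.
under eq_integral => t _.
  rewrite big_cons -/(W t) {1}(splitmax (Z b t)) mulrBl EFinB.
over.
rewrite integralB // EpW EnW big_cons -/EW -muleBl //; last first.
  by apply: fin_num_adde_defr; exact: integrable_fin_num.
congr (_ * _)%E; rewrite -integralB //.
by apply: eq_integral => t _; rewrite -EFinB -splitmax.
Qed.

Theorem integral_prod_indep (s : seq I) (Z : I -> T -> R) :
  uniq s -> [set` s] `<=` D ->
  (forall b, b \in s -> adapted Z b) ->
  (forall b, b \in s -> P.-integrable setT (EFin \o Z b)) ->
  (\int[P]_t (\prod_(b <- s) Z b t)%:E = \prod_(b <- s) \int[P]_t (Z b t)%:E)%E.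
Proof.
by move=> us sD aZ iZ; rewrite -(cats0 s); apply: integral_prod_partly_signed; rewrite ?cats0.
Qed.
End independent_product.


(** * Expected weight of a walk *)
Section finite_lemmas.

Lemma prod_blocks (I J : eqType) (S : comPzRingType) (f : I -> J) (F : I -> S) (l : seq I) :
  \prod_(e <- l) F e = \prod_(b <- undup (map f l)) \prod_(e <- l | f e == b) F e.
Proof.
rewrite (exchange_big_dep xpredT) //= big_seq [RHS]big_seq.
apply: eq_bigr => e el; rewrite -big_filter.
have -> : [seq b <- undup (map f l) | f e == b] = [:: f e].
  rewrite (@eq_filter _ _ (pred1 (f e))); last by move=> b; rewrite /= eq_sym.
  by rewrite filter_pred1_uniq ?undup_uniq // mem_undup map_f.
by rewrite big_seq1.
Qed.

Lemma filter_fiber_uniq (I J : eqType) (f : I -> J) (L : seq I) x :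
  uniq (map f L) -> x \in L -> [seq e <- L | f e == f x] = [:: x].
Proof.
elim: L => //= e L IHL /andP[fe uL]; rewrite inE => /orP[/eqP -> | xL].
  rewrite eqxx; congr (_ :: _); apply/eqP; rewrite -[_ == _]negbK -has_filter.
  by apply/hasPn => z zL; apply: contra fe => /eqP <-; exact: map_f.
case: eqP => [fex|_]; last exact: IHL.
by rewrite fex map_f in fe.
Qed.


(** The product is at most the power of its largest factor, which is one of the
    summands; the term 1 is for the empty product. *)
Lemma prodr_le_1Dsum (R : realDomainType) (I : eqType) (s : seq I) (x : I -> R) :
  (forall i, 0 <= x i) ->
  \prod_(i <- s) x i <= 1 + \sum_(i <- s) x i ^+ size s.
Proof.
move=> x0; case: s => [|i0 s]; first by rewrite !big_nil addr0.
set l := i0 :: s.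
have [i il imax] : exists2 i, i \in l & forall j, j \in l -> x j <= x i.
  rewrite {}/l; elim: s i0 => [|i1 s IHs] i0.
    by exists i0; rewrite ?mem_head // => j; rewrite inE => /eqP ->.
  have [i il imax] := IHs i1.
  have [h|h] := leP (x i0) (x i).
    exists i; first by rewrite inE il orbT.
    by move=> j; rewrite inE => /orP[/eqP -> //|]; exact: imax.
  exists i0; rewrite ?mem_head // => j; rewrite inE => /orP[/eqP -> //|jl].
  by rewrite (le_trans (imax j jl)) // ltW.
have h1 : \prod_(j <- l) x j <= x i ^+ size l.
  have -> : x i ^+ size l = \prod_(j <- l) x i.
    by rewrite big_const_seq count_predT iter_mulr_1.
  rewrite big_seq [leRHS]big_seq; apply: ler_prod => j jl.
  by rewrite x0 imax.
apply: (le_trans h1); rewrite (big_rem i) //= addrCA ler_wpDr // addr_ge0 //.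
by apply: sumr_ge0 => j _; rewrite exprn_ge0.
Qed.

End finite_lemmas.

Section walk_expectation.
Context d (T : measurableType d) (R : realType) (P : probability T R).
Variable a : nat -> nat -> {RV P >-> R}.
Hypothesis a_indep : independent_entries P (fun i j => a i j : T -> R).
Hypothesis a_mean : forall i j : nat, ('E_P[a i j] = 0)%E.
Hypothesis a_var : forall i j : nat, ('E_P[fun t => (a i j t ^+ 2)%R] = 1)%E.
Hypothesis a_moments : forall q : nat,
  (ereal_sup (range (fun ij : nat * nat =>
    'E_P[fun t => (`|a ij.1 ij.2 t| ^+ q)%R])) < +oo)%E.

Definition entry_prod (l : seq (nat * nat)) (t : T) : R :=
  \prod_(e <- l) a e.1 e.2 t.

Lemma measurable_entry_prod l : measurable_fun setT (entry_prod l).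
Proof. by apply: measurable_prod. Qed.

Lemma entry_moment_bound : exists C : nat -> R,
  (forall q, 0 <= C q) /\
  (forall q i j, \int[P]_t (`|a i j t| ^+ q)%:E <= (C q)%:E)%E.
Proof.
pose S q := ereal_sup (range (fun ij : nat * nat =>
    'E_P[fun t => (`|a ij.1 ij.2 t| ^+ q)%R]%E)).
have S_ge q i j : (\int[P]_t (`|a i j t| ^+ q)%:E <= S q)%E.
  by apply: ereal_sup_ubound; exists (i, j) => //; rewrite unlock.
have S0 q : (0 <= S q)%E.
  apply: le_trans (S_ge q 0 0)%N.
  by apply: integral_ge0 => t _; rewrite lee_fin exprn_ge0.
exists (fun q => fine (S q)); split; first by move=> q; rewrite fine_ge0.
move=> q i j.
rewrite fineK; first exact: S_ge.
by rewrite ge0_fin_numE //; exact: a_moments.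
Qed.

Lemma entry_prod_moment : exists C : nat -> R, (forall m, 0 <= C m) /\
  forall l, (\int[P]_t (`|entry_prod l t|)%:E <= (C (size l))%:E)%E.
Proof.
have [C [C0 CE]] := entry_moment_bound.
exists (fun m => 1 + m%:R * C m); split=> [m|l].
  by rewrite addr_ge0 // mulr_ge0.
have mX e q : measurable_fun setT (fun t => (`|a e.1 e.2 t| ^+ q)%:E).
  by apply/measurable_EFinP/measurable_funX/measurableT_comp; first exact: normr_measurable.
apply: (@le_trans _ _ (\int[P]_t (1 + \sum_(e <- l) (`|a e.1 e.2 t| ^+ size l)%:E))%E).
  apply: ge0_le_integral => //.
  - by apply/measurable_EFinP/measurableT_comp; [exact: normr_measurable|exact: measurable_entry_prod].
  - apply: emeasurable_funD => //; exact: emeasurable_sum.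
  - move=> t _; rewrite sumEFin -EFinD lee_fin /entry_prod normr_prod.
    exact: (@prodr_le_1Dsum R _ l (fun e : nat * nat => `|a e.1 e.2 t|)).
rewrite ge0_integralD //; first last.
- exact: emeasurable_sum.
- by move=> t _; apply: sume_ge0 => e _; rewrite lee_fin exprn_ge0.
have -> : (\int[P]__ 1 = 1)%E.
  by rewrite integral_cst // mul1e; exact: probability_setT.
rewrite ge0_integral_sum //.
rewrite EFinD leeD2l //.
apply: (@le_trans _ _ (\sum_(e <- l) (C (size l))%:E)%E).
  by apply: lee_sum => e _; exact: CE.
rewrite sumEFin lee_fin big_const_seq count_predT iter_addr_0.
by rewrite mulr_natl.
Qed.

Lemma integrable_entry_prod l : P.-integrable setT (EFin \o entry_prod l).
Proof.
have [C [C0 CE]] := entry_prod_moment; apply/integrableP; split.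
  exact/measurable_EFinP/measurable_entry_prod.
by rewrite (le_lt_trans (CE l)) // ltry.
Qed.

Definition block_prod (l : seq (nat * nat)) (b : nat + nat * nat) (t : T) : R :=
  \prod_(e <- l | letter_edge e == b) a e.1 e.2 t.

Lemma block_prodE l b : block_prod l b = entry_prod [seq e <- l | letter_edge e == b].
Proof. by apply/funext => t; rewrite /entry_prod big_filter. Qed.

Let G := entry_sigma_algebra (fun i j => a i j : T -> R).

Lemma entry_sigma_algebra_measurable b A : G b A -> measurable A.
Proof.
case: b => [i|[i j]] [B mB <-].
  by apply: (measurable_funP (a i i)).
have mp : measurable_fun setT (fun t => (a i j t, a j i t)).
  by apply: measurable_fun_pair.
exact: mp.
Qed.

Lemma letter_edge_inl (e : nat * nat) i : letter_edge e = inl i -> e = (i, i).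
Proof.
by case: e => u v; rewrite /letter_edge /edge /=; case: eqP => // -> [->].
Qed.

Lemma letter_edge_inr (e : nat * nat) i j : letter_edge e = inr (i, j) ->
  e = if (e.1 < e.2)%N then (i, j) else (j, i).
Proof.
case: e => u v; rewrite /letter_edge /edge /=; case: eqP => // uv [<- <-].
by case: ltngtP uv.
Qed.


(** All letters on one edge are entries a_ij or a_ji for the same pair, so their
    product is a function of the variable attached to that edge. *)
Lemma adapted_block_prod l b : adapted G (block_prod l) b.
Proof.
split=> [|B mB]; first by rewrite block_prodE; exact: measurable_entry_prod.
case: b => [i|[i j]].
  pose h (x : R) := \prod_(e <- [seq e <- l | letter_edge e == inl i]) x.
  have mh : measurable_fun setT h by apply: measurable_prod.
  have -> : block_prod l (inl i) = h \o a i i.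
    apply/funext => t; rewrite /h /= big_filter; apply: eq_bigr => e /eqP/letter_edge_inl eE.
    by rewrite eE.
  by exists (h @^-1` B); [rewrite -[X in measurable X]setTI; exact: mh|rewrite setTI].
pose h (x : R * R) := \prod_(e <- [seq e <- l | letter_edge e == inr (i, j)])
  (if (e.1 < e.2)%N then x.1 else x.2).
have mh : measurable_fun setT h.
  apply: measurable_prod => e _; case: (e.1 < e.2)%N; first exact: measurable_fst.
  exact: measurable_snd.
have -> : block_prod l (inr (i, j)) = h \o (fun t => (a i j t, a j i t)).
  apply/funext => t; rewrite /h /= big_filter; apply: eq_bigr => e /eqP/letter_edge_inr.
  by case: ifP => _ eE; rewrite eE.
by exists (h @^-1` B); [rewrite -[X in measurable X]setTI; exact: mh|rewrite setTI].
Qed.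

Lemma letter_edge_index e : entry_index (letter_edge e).
Proof.
rewrite /letter_edge /edge; case: eqP => //= /eqP; rewrite neq_ltn.
by case: ltngtP.
Qed.

Lemma integral_entry_prod l :
  (\int[P]_t (entry_prod l t)%:E =
   \prod_(b <- undup (map letter_edge l)) \int[P]_t (block_prod l b t)%:E)%E.
Proof.
under eq_integral do rewrite /entry_prod (prod_blocks letter_edge).
rewrite -(integral_prod_indep a_indep entry_sigma_algebra_measurable) //.
- exact: undup_uniq.
- by move=> b /=; rewrite mem_undup => /mapP[e _ ->]; exact: letter_edge_index.
- by move=> b _; exact: adapted_block_prod.
- by move=> b _; rewrite block_prodE; exact: integrable_entry_prod.
Qed.

Lemma integral_entry_prod_single l e : e \in l ->
  count_mem (letter_edge e) (map letter_edge l) = 1%N -> (\int[P]_t (entry_prod l t)%:E = 0)%E.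
Proof.
move=> el; rewrite count_map -size_filter.
rewrite (@eq_filter _ _ (fun x => letter_edge x == letter_edge e)) // => se.
rewrite integral_entry_prod (bigD1_seq (letter_edge e)) ?undup_uniq ?mem_undup ?map_f //=.
rewrite block_prodE.
have : e \in [seq x <- l | letter_edge x == letter_edge e] by rewrite mem_filter eqxx.
case: [seq _ <- _ | _] se => [|e' []] //= _; rewrite inE => /eqP <-.
rewrite /entry_prod; under eq_integral do rewrite big_seq1.
by have := a_mean e.1 e.2; rewrite unlock => ->; rewrite mul0e.
Qed.

Lemma integral_entry_prod_pairs l L : perm_eq l (L ++ L) -> uniq (map letter_edge L) ->
  (\int[P]_t (entry_prod l t)%:E = 1)%E.
Proof.
move=> pl uL; rewrite integral_entry_prod big_seq big1 // => b.
rewrite mem_undup => /mapP[e]; rewrite (perm_mem pl) mem_cat orbb => eL ->.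
have eF : block_prod l (letter_edge e) = fun t => a e.1 e.2 t ^+ 2.
  apply/funext => t; rewrite /block_prod (perm_big _ pl) big_cat /=.
  by rewrite -big_filter filter_fiber_uniq // big_seq1 expr2.
by rewrite eF; have := a_var e.1 e.2; rewrite unlock.
Qed.

End walk_expectation.


(** * Convergence of the moments *)
Section moment_limit.
Context d (T : measurableType d) (R : realType) (P : probability T R).
Variable a : nat -> nat -> {RV P >-> R}.
Hypothesis a_indep : independent_entries P (fun i j => a i j : T -> R).
Hypothesis a_mean : forall i j : nat, ('E_P[a i j] = 0)%E.
Hypothesis a_var : forall i j : nat, ('E_P[fun t => (a i j t ^+ 2)%R] = 1)%E.
Hypothesis a_moments : forall q : nat,
  (ereal_sup (range (fun ij : nat * nat =>
    'E_P[fun t => (`|a ij.1 ij.2 t| ^+ q)%R])) < +oo)%E.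

Definition entry_expectation l : R := fine (\int[P]_t (entry_prod a l t)%:E)%E.

Lemma entry_expectation_bound : exists2 C : nat -> R, (forall m, 0 <= C m) &
  forall l, `|entry_expectation l| <= C (size l).
Proof.
have [C [C0 CE]] := entry_prod_moment a_moments; exists C => // l.
have fin : (\int[P]_t (entry_prod a l t)%:E \is a fin_num)%E.
  by apply: integrable_fin_num => //; exact: integrable_entry_prod.
rewrite -lee_fin -abse_EFin fineK //; apply: le_trans (CE l).
apply: le_abse_integral => //.
exact/measurable_EFinP/measurable_entry_prod.
Qed.


(** A closed walk with at least k+1 vertices has mean 1 or 0 according to whether it is
    depth-first; a depth-first walk is closed by itself. *)
Lemma entry_expectation_walk v r k : size r = k.*2 -> (k <= new_vertices [:: v] r)%N ->
  (last v r == v)%:R * entry_expectation (letters true v r) = (dfs [:: v] v [::] r)%:R.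
Proof.
move=> szr kr; case: (boolP (dfs [:: v] v [::] r)) => [dfs_r|ndfs].
  rewrite (dfs_last dfs_r) eqxx mul1r.
  have [L [pL uL _]] := dfs_letters true dfs_r (fun z => id).
  by rewrite /entry_expectation (integral_entry_prod_pairs a_indep a_var a_moments pL uL).
pose es := pairmap edge v r.
case: (boolP (has (fun e => count_mem e es == 1%N) es)) => [/hasP[e ees /eqP ce]|/hasPn nsingle].
  move: ees ce; rewrite /es -(map_edge_letters true) => /mapP[l ll ->] ce.
  by rewrite /entry_expectation (integral_entry_prod_single a_indep a_mean a_moments ll ce) mulr0.
case/negP: ndfs; apply: (@dfs_of_repeated_edges _ _ _ _ [::]) => //.
  move=> e er _; have := nsingle e er; have := er.
  by rewrite -/es -has_pred1 has_count; case: (count_mem e es) => [|[]].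
by rewrite szr addn0; lia.
Qed.

Definition walk_sum n p k : R :=
  \sum_(0 <= v < p) \sum_(r <- walks n p true k.*2 | last v r == v)
     entry_expectation (letters true v r).

Let trace_walks n p k t : \tr (sample_covariance (fun i j => a i j : T -> R) p n t ^+ k) =
  n%:R^-1 ^+ k * \sum_(0 <= v < p)
    \sum_(r <- walks n p true k.*2 | last v r == v) entry_prod a (letters true v r) t.
Proof. exact: (trace_scaled_gram_exp (fun i j => a i j t)). Qed.

Let integrable_walks n p k v : P.-integrable setT (fun t =>
  (\sum_(r <- walks n p true k.*2 | last v r == v) entry_prod a (letters true v r) t)%:E).
Proof.
under eq_fun do rewrite -sumEFin.
by apply: integrable_sum => // r _; exact: integrable_entry_prod.
Qed.

Lemma integrable_trace_sample_covariance n p k : P.-integrable setT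
  (fun t => (\tr (sample_covariance (fun i j => a i j : T -> R) p n t ^+ k))%:E).
Proof.
under eq_fun do rewrite trace_walks EFinM -sumEFin.
by apply: integrableZl => //; apply: integrable_sum.
Qed.

Lemma phi_walk_sum n p k :
  phi_ P (fun t => sample_covariance (fun i j => a i j : T -> R) p n t ^+ k) =
  p%:R^-1 * (n%:R^-1 ^+ k * walk_sum n p k).
Proof.
rewrite /phi_ unlock; congr (_ * _).
under eq_integral do rewrite trace_walks EFinM -sumEFin.
have iS := integrable_walks n p k.
rewrite integralZl //; last by apply: integrable_sum.
rewrite fineM //; last by apply: integrable_fin_num => //; exact: integrable_sum.
congr (_ * _); rewrite integral_sum // -sum_fine; last first.
  by move=> v _; exact: integrable_fin_num.
apply: eq_bigr => v _; under eq_integral do rewrite -sumEFin.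
have iE r : P.-integrable setT (EFin \o entry_prod a (letters true v r)).
  exact: integrable_entry_prod.
rewrite integral_sum // -sum_fine // => r _.
by apply: integrable_fin_num => //; exact: iE.
Qed.

Definition dfs_total n p k : nat :=
  (\sum_(0 <= v < p) dfs_count n p true k.*2 [:: v] v [::])%N.


(** The two sums differ only on walks with at most k vertices, the starting vertex
    being one of them; this is where the exponent [k.-1] comes from.  There are none when
    k = 0, which the factor [0 < k] records. *)
Lemma walk_sum_dfs k : exists2 B : R, 0 <= B & forall n p,
  `|walk_sum n p k - (dfs_total n p k)%:R| <=
    B * p%:R * (n + p)%:R ^+ k.-1 *+ (0 < k)%N.
Proof.
have [C C0 CE] := entry_expectation_bound.
exists ((C k.*2 + 1) * (k.*2.+2 ^ k.*2)%:R) => [|n p].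
  by rewrite mulr_ge0 ?addr_ge0.
rewrite /walk_sum /dfs_total natr_sum -sumrB.
apply: le_trans (ler_norm_sum _ _ _) _.
pose bad v r := (new_vertices [:: v] r < k)%N.
have step v : (v < p)%N ->
    `|\sum_(r <- walks n p true k.*2 | last v r == v) entry_expectation (letters true v r)
       - (dfs_count n p true k.*2 [:: v] v [::])%:R|
    <= (C k.*2 + 1) * (count (bad v) (walks n p true k.*2))%:R.
  move=> vp; rewrite /dfs_count -!sum1_count !natr_sum.
  rewrite [X in `|X - _|]big_mkcond [X in `|_ - X|]big_mkcond.
  rewrite [X in _ * X]big_mkcond big_distrr /= -sumrB.
  apply: le_trans (ler_norm_sum _ _ _) _.
  rewrite big_seq [leRHS]big_seq; apply: ler_sum => r /mem_walks_size szr.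
  have := @entry_expectation_walk v r k szr; rewrite /bad.
  case: ltnP => [_ _|kr /(_ isT)].
    rewrite mulr1; apply: le_trans (ler_normB _ _) _; apply: lerD.
      case: ifP => _; last by rewrite normr0.
      by rewrite (le_trans (CE _)) // size_letters szr.
    by case: ifP => _; rewrite ?normr0 ?normr1.
  rewrite mulr0 normr_le0 subr_eq0.
  by case: (last v r == v); case: (dfs _ _ _ _); rewrite ?mul1r ?mul0r => /eqP.
have few v : (count (bad v) (walks n p true k.*2) <=
    k.*2.+2 ^ k.*2 * (n + p) ^ k.-1 * (0 < k))%N.
  case: k @bad {C0 CE step} => [|k] bad.
    by rewrite (@eq_count _ _ pred0) ?count_pred0.
  rewrite muln1; have [np0|np0] := posnP (n + p)%N.
    have -> : n = 0%N by lia.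
    by have -> : p = 0%N by lia.
  by apply: (@count_few_vertices _ _ _ k.+1.*2.+1) => //; rewrite ?leq_addr ?leq_addl.
apply: (@le_trans _ _ (\sum_(0 <= v < p)
   (C k.*2 + 1) * (k.*2.+2 ^ k.*2 * (n + p) ^ k.-1 * (0 < k))%:R)).
  rewrite big_seq [leRHS]big_seq; apply: ler_sum => v.
  rewrite mem_index_iota => /andP[_ vp]; apply: le_trans (step v vp) _.
  by rewrite ler_wpM2l ?addr_ge0 // ler_nat few.
rewrite sumr_const_nat subn0 -mulr_natr -[leRHS]mulr_natr !natrM !natrX.
set u := _ ^+ k.*2; set w := _ ^+ k.-1.
by rewrite le_eqVlt; apply/orP; left; apply/eqP; ring.
Qed.

Lemma dfs_total_bounds n p k :
  (p * @path_weight nat (n - k.*2.+1)%N (p - k.*2.+1)%N true k.*2 0 <= dfs_total n p k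
    <= p * @path_weight nat n p true k.*2 0)%N.
Proof.
set K := k.*2.+1; have bnd v : (v < p)%N ->
    (@path_weight nat (n - K)%N (p - K)%N true k.*2 0
     <= dfs_count n p true k.*2 [:: v] v [::]
     <= @path_weight nat n p true k.*2 0)%N.
  by move=> vp; apply: (@dfs_count_bounds n p K true k.*2 [:: v] v [::]).
have cst c : (p * c = \sum_(0 <= v < p) c)%N by rewrite sum_nat_const_nat subn0.
rewrite /dfs_total !cst; apply/andP; split.
  rewrite big_seq [leqRHS]big_seq; apply: leq_sum => v.
  by rewrite mem_index_iota => /andP[_ /bnd/andP[]].
rewrite big_seq [leqRHS]big_seq; apply: leq_sum => v.
by rewrite mem_index_iota => /andP[_ /bnd/andP[]].
Qed.

Lemma walk_sum_normalized k : exists2 B : R, 0 <= B & forall n p,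
  (0 < n)%N -> (0 < p)%N ->
  path_weight ((n - k.*2.+1)%:R / n%:R) ((p - k.*2.+1)%:R / n%:R) true k.*2 0
      - B * (1 + p%:R / n%:R) ^+ k.-1 / n%:R
    <= p%:R^-1 * (n%:R^-1 ^+ k * walk_sum n p k)
    <= path_weight 1 (p%:R / n%:R) true k.*2 0
      + B * (1 + p%:R / n%:R) ^+ k.-1 / n%:R.
Proof.
have [B B0 HB] := walk_sum_dfs k; exists B => // n p n0 p0.
set m := p%:R^-1 * _; set err := B * _ / _.
have n0' : n%:R != 0 :> R by rewrite pnatr_eq0 -lt0n.
have p0' : p%:R != 0 :> R by rewrite pnatr_eq0 -lt0n.
pose s : R := p%:R^-1 * n%:R^-1 ^+ k.
have s0 : 0 <= s by rewrite mulr_ge0 ?invr_ge0 // exprn_ge0 // invr_ge0.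
have mE : m = s * walk_sum n p k by rewrite /m /s mulrA.
have pwE (u v : nat) : s * (p * @path_weight nat u v true k.*2 0)%:R =
    path_weight (u%:R / n%:R) (v%:R / n%:R) true k.*2 0 :> R.
  rewrite natrM path_weight_natr -![_%:R / n%:R]mulrC.
  rewrite (@path_weight_scale _ n%:R^-1 _ _ _ _ _ k) ?addn0 // /s.
  by rewrite mulrACA mulVf // mul1r.
have errE : s * (B * p%:R * (n + p)%:R ^+ k.-1 *+ (0 < k)%N) <= err.
  rewrite /err; case: k @s s0 {mE pwE m HB err} => [|k] s s0.
    by rewrite mulr0n mulr0 expr0 mulr1 divr_ge0.
  rewrite mulr1n /s /= exprS.
  have -> : (n + p)%:R = n%:R * (1 + p%:R / n%:R) :> R.
    by rewrite natrD mulrDr mulr1 mulrCA divff // mulr1.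
  rewrite exprMn exprVn le_eqVlt; apply/orP; left; apply/eqP.
  have nk0 : n%:R ^+ k != 0 :> R by rewrite expf_neq0.
  set u := _ ^+ k in nk0 *; set w := _ ^+ k.
  by field; rewrite n0' p0' nk0.
have [lo hi] := andP (dfs_total_bounds n p k).
have := HB n p; rewrite ler_distl => /andP[H1 H2].
have := ler_wpM2l s0 H1; have := ler_wpM2l s0 H2.
rewrite mulrBr mulrDr -mE => {H1 H2} H1 H2.
have lo' : path_weight ((n - k.*2.+1)%:R / n%:R) ((p - k.*2.+1)%:R / n%:R) true k.*2 0
    <= s * (dfs_total n p k)%:R by rewrite -pwE ler_wpM2l // ler_nat.
have hi' : s * (dfs_total n p k)%:R <= path_weight 1 (p%:R / n%:R) true k.*2 0.
  by rewrite -[X in path_weight X](divff n0') -pwE ler_wpM2l // ler_nat.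
by apply/andP; split; lra.
Qed.

Variables (n : nat -> nat) (y : R).
Hypothesis y_gt0 : 0 < y.
Hypothesis n_lim : (p%:R / (n p)%:R : R) @[p --> \oo] --> y.

Let inv_n : ((n p)%:R^-1 : R) @[p --> \oo] --> (0 : R).
Proof.
have H : (p%:R / (n p)%:R * p%:R^-1 : R) @[p --> \oo] --> y * 0.
  by apply: cvgM => //; rewrite -cvg_shiftS; exact: cvg_harmonic.
rewrite mulr0 in H; apply: cvg_trans H; apply: near_eq_cvg; near=> p.
have p0 : p%:R != 0 :> R by rewrite pnatr_eq0 -lt0n; near: p; exists 1%N.
by rewrite mulrAC mulfV // mul1r.
Unshelve. all: by end_near. Qed.

Let n_gt0 : \forall p \near \oo, (0 < n p)%N.
Proof.
near=> p; rewrite lt0n; apply/negP => /eqP np0.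
have : 0 < p%:R / (n p)%:R :> R by near: p; exact: (cvgr_gt y).
by rewrite np0 invr0 mulr0 ltxx.
Unshelve. all: by end_near. Qed.

Let n_ge K : \forall p \near \oo, (K <= n p)%N.
Proof.
near=> p; have n0 : (0 < n p)%N by near: p.
have : (n p)%:R^-1 < K.+1%:R^-1 :> R.
  by near: p; apply: (cvgr_lt 0) => //; rewrite invr_gt0.
by rewrite ltf_pV2 ?posrE ?ltr0n // ltr_nat => /ltnW/ltnW.
Unshelve. all: by end_near. Qed.

Theorem sample_covariance_moments k :
  phi_ P (fun t => sample_covariance (fun i j => a i j : T -> R) p (n p) t ^+ k)
    @[p --> \oo] --> (path_weight 1 y true k.*2 0 : R).
Proof.
have [B B0 HB] := walk_sum_normalized k.
pose K := k.*2.+1.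
pose err p : R := B * (1 + p%:R / (n p)%:R) ^+ k.-1 / (n p)%:R.
have err0 : err p @[p --> \oo] --> 0.
  rewrite -(mulr0 (B * (1 + y) ^+ k.-1)); apply: cvgM => //.
  apply: cvgM; first exact: cvg_cst.
  apply: (@cvg_comp _ _ _ (fun p => 1 + p%:R / (n p)%:R) (fun x : R => x ^+ k.-1) _ (nbhs (1 + y))).
    by apply: cvgD => //; exact: cvg_cst.
  exact: exprn_continuous.
have c1 : ((n p - K)%:R / (n p)%:R : R) @[p --> \oo] --> (1 : R).
  have H : (1 - K%:R * (n p)%:R^-1 : R) @[p --> \oo] --> (1 - K%:R * 0 : R).
    by apply: cvgB; [exact: cvg_cst | apply: cvgM => //; exact: cvg_cst].
  rewrite mulr0 subr0 in H; apply: cvg_trans H; apply: near_eq_cvg; near=> p.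
  have nK : (K <= n p)%N by near: p.
  have n0 : (n p)%:R != 0 :> R by rewrite pnatr_eq0 -lt0n (leq_trans _ nK).
  by rewrite natrB // mulrBl divff.
have c2 : ((p - K)%:R / (n p)%:R : R) @[p --> \oo] --> y.
  have H : (p%:R / (n p)%:R - K%:R * (n p)%:R^-1 : R) @[p --> \oo] --> (y - K%:R * 0 : R).
    by apply: cvgB => //; apply: cvgM => //; exact: cvg_cst.
  rewrite mulr0 subr0 in H; apply: cvg_trans H; apply: near_eq_cvg; near=> p.
  have pK : (K <= p)%N by near: p; exists K.
  by rewrite natrB // mulrBl.
apply: (@squeeze_cvgr _ _ _ _
  (fun p => path_weight ((n p - K)%:R / (n p)%:R) ((p - K)%:R / (n p)%:R) true k.*2 0 - err p)
  (fun p => path_weight 1 (p%:R / (n p)%:R) true k.*2 0 + err p)).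
- near=> p; rewrite phi_walk_sum; apply: HB; first by near: p.
  by near: p; exists 1%N.
- rewrite -[X in _ --> X]subr0; apply: cvgB => //; exact: cvg_path_weight.
- rewrite -[X in _ --> X]addr0; apply: cvgD => //; apply: cvg_path_weight => //.
  exact: cvg_cst.
Unshelve. all: by end_near. Qed.

End moment_limit.


(** * Trigonometric integrals *)
Section trig_integrals.
Context (R : realType).
Notation mu := (@lebesgue_measure R).

Definition int0pi (f : R -> R) : R := \int[mu]_(t in `[0, pi]) f t.

Lemma integrable_0pi (f : R -> R) : continuous f -> mu.-integrable `[0, pi] (EFin \o f).
Proof.
move=> cf; apply: continuous_compact_integrable; first exact: segment_compact.
exact: continuous_subspaceT.
Qed.

Lemma int0piD (f g : R -> R) : continuous f -> continuous g ->
  int0pi (fun t => f t + g t) = int0pi f + int0pi g.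
Proof. by move=> cf cg; apply: RintegralD => //; exact: integrable_0pi. Qed.

Lemma int0piZ (c : R) (f : R -> R) : continuous f -> int0pi (fun t => c * f t) = c * int0pi f.
Proof. by move=> cf; apply: RintegralZl => //; exact: integrable_0pi. Qed.

Lemma continuousMR (f g : R -> R) : continuous f -> continuous g ->
  continuous (fun x => f x * g x).
Proof. by move=> cf cg x; apply: cvgM; [exact: cf|exact: cg]. Qed.

Lemma continuousDR (f g : R -> R) : continuous f -> continuous g ->
  continuous (fun x => f x + g x).
Proof. by move=> cf cg x; apply: cvgD; [exact: cf|exact: cg]. Qed.

Lemma continuous_cstR (c : R) : continuous (fun _ : R => c).
Proof. by move=> x; exact: cvg_cst. Qed.

Lemma continuousXR (f : R -> R) k : continuous f -> continuous (fun x => f x ^+ k).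
Proof.
move=> cf; elim: k => [|k IHk]; first exact: continuous_cstR.
rewrite (_ : (fun x => _) = (fun x => f x * f x ^+ k)); first exact: continuousMR.
by apply/funext => x; rewrite exprS.
Qed.

Lemma continuous_sinZ (c : R) : continuous (fun t => sin (c * t)).
Proof.
move=> x; apply: (@continuous_comp _ _ _ (fun t => c * t) sin); last exact: continuous_sin.
exact: mulrl_continuous.
Qed.

Lemma continuous_cosZ (c : R) : continuous (fun t => cos (c * t)).
Proof.
move=> x; apply: (@continuous_comp _ _ _ (fun t => c * t) cos); last exact: continuous_cos.
exact: mulrl_continuous.
Qed.

Lemma sin_natpi m : sin (m%:R * pi) = 0 :> R.
Proof.
elim: m => [|m IHm]; first by rewrite mul0r sin0.
by rewrite -natr1 mulrDl mul1r sinDpi IHm oppr0.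
Qed.

Lemma int0pi_cos m : int0pi (fun t => cos (m%:R * t)) = if m == 0%N then pi else 0.
Proof.
case: eqP => [->|/eqP m0].
  rewrite /int0pi; under eq_Rintegral do rewrite mul0r cos0.
  rewrite Rintegral_cst // mul1r.
  rewrite -[LHS]/(fine (lebesgue_measure (`[0, pi]%classic : set R))).
  by rewrite lebesgue_measure_itv /= lte_fin pi_gt0 -EFinB subr0.
have m0' : m%:R != 0 :> R by rewrite pnatr_eq0.
pose F t : R := sin (m%:R * t) / m%:R.
have dF x : is_derive x (1 : R) F (cos (m%:R * x)).
  have dg : is_derive x (1 : R) (m%:R \*: (@id R)) (m%:R *: (1 : R)).
    by apply: is_deriveZ; exact: is_derive_id.
  have dc : is_derive x (1 : R) (sin \o (m%:R \*: (@id R))) (cos (m%:R * x) * (m%:R *: (1 : R))).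
    exact: is_derive1_comp.
  rewrite (_ : F = m%:R^-1 \*: (sin \o (m%:R \*: (@id R)))); last first.
    by apply/funext => t; rewrite /F /= mulrC.
  apply: (@is_derive_eq _ _ _ _ _ _ _ _ (is_deriveZ _ dc)).
  by rewrite /GRing.scale /= mulr1 mulrCA mulVf // mulr1.
have cF : continuous F.
  by apply: continuousMR; [exact: continuous_sinZ|exact: continuous_cstR].
rewrite /int0pi /Rintegral (@continuous_FTC2 _ _ F) ?pi_gt0 //.
- by rewrite -EFinB /F mulr0 sin0 sin_natpi mul0r subrr.
- exact/continuous_subspaceT/continuous_cosZ.
- split.
  + by move=> x _; have [] := dF x.
  + exact/cvg_at_right_filter/cF.
  + exact/cvg_at_left_filter/cF.
- by move=> x _; rewrite derive1E (@derive_val _ _ _ _ _ _ _ (dF x)).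
Qed.

Lemma int0pi_sin_sin h :
  int0pi (fun t => sin t * sin (h.+1%:R * t)) = if h == 0%N then pi / 2 else 0.
Proof.
have -> : (fun t : R => sin t * sin (h.+1%:R * t)) =
    (fun t : R => 2^-1 * (cos (h%:R * t) + (-1) * cos (h.+2%:R * t))).
  apply/funext => t.
  have -> : h%:R * t = h.+1%:R * t - t by rewrite -natr1; ring.
  have -> : h.+2%:R * t = h.+1%:R * t + t by rewrite -[h.+2%:R]natr1; ring.
  by rewrite cosB cosD; field.
rewrite int0piZ; last first.
  apply: continuousDR; first exact: continuous_cosZ.
  by apply: continuousMR; [exact: continuous_cstR|exact: continuous_cosZ].
rewrite int0piD; [|exact: continuous_cosZ|]; last first.
  by apply: continuousMR; [exact: continuous_cstR|exact: continuous_cosZ].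
rewrite int0piZ; last exact: continuous_cosZ.
by rewrite !int0pi_cos /=; case: eqP => _; ring.
Qed.

End trig_integrals.


(** * The semicircle behind the Marchenko-Pastur density *)
Section mp_substitution.
Context (R : realType) (y : R).
Hypothesis y_gt0 : 0 < y.
Notation mu := (@lebesgue_measure R).

Let z := Num.sqrt y.
Let z_gt0 : 0 < z. Proof. by rewrite sqrtr_gt0. Qed.
Let zz : z * z = y. Proof. by rewrite -expr2 sqr_sqrtr ?ltW. Qed.

Definition mp_angle (t : R) : R := 1 + y + 2 * z * cos t.

Lemma continuous_mp_angle : continuous mp_angle.
Proof.
apply: continuousDR; first exact: continuous_cstR.
by apply: continuousMR; [exact: continuous_cstR|exact: continuous_cos].
Qed.

Lemma mp_rightE : mp_right y = 1 + y + 2 * z.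
Proof. by rewrite /mp_right -/z -zz; ring. Qed.

Lemma mp_leftE : mp_left y = 1 + y - 2 * z.
Proof. by rewrite /mp_left -/z -zz; ring. Qed.

Lemma mp_left_ge0 : 0 <= mp_left y. Proof. exact: sqr_ge0. Qed.

Lemma mp_left_lt_right : mp_left y < mp_right y.
Proof. by rewrite mp_leftE mp_rightE; have := z_gt0; lra. Qed.

Lemma mp_right_gt0 : 0 < mp_right y.
Proof. exact: le_lt_trans mp_left_ge0 mp_left_lt_right. Qed.

Definition mp_root (x : R) : R := Num.sqrt ((mp_right y - x) * (x - mp_left y)).

Lemma mp_root_angle t : t \in `[0, pi] -> mp_root (mp_angle t) = 2 * z * sin t.
Proof.
rewrite in_itv /= => /sin_ge0_pi st; rewrite /mp_root mp_rightE mp_leftE /mp_angle.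
rewrite [X in Num.sqrt X](_ : _ = (2 * z * sin t) ^+ 2).
  by rewrite sqrtr_sqr ger0_norm // !mulr_ge0 // ltW.
by rewrite !exprMn sin2cos2; ring.
Qed.

Lemma continuous_mp_root : continuous mp_root.
Proof.
move=> x; apply: (@continuous_comp _ _ _ (fun x => (mp_right y - x) * (x - mp_left y))).
  by apply: cvgM; apply: cvgB; try exact: cvg_cst; exact: cvg_id.
exact: sqrt_continuous.
Qed.

Lemma mp_substitution (G : R -> R) :
  {within `[mp_left y, mp_right y], continuous G} ->
  (\int[mu]_(x in `[mp_left y, mp_right y]) (G x * mp_root x)%:E
   = \int[mu]_(t in `[0%R, pi]) (G (mp_angle t) * (4 * y * (sin t * sin t)))%:E)%E.
Proof.
move=> cG.
have F0 : mp_angle 0 = mp_right y by rewrite /mp_angle cos0 mulr1 mp_rightE.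
have Fpi : mp_angle pi = mp_left y by rewrite /mp_angle cospi mulrN1 mp_leftE.
have dF x : is_derive x (1 : R) mp_angle (- (2 * z * sin x)).
  have dc : is_derive x (1 : R) ((2 * z) \*: (@cos R)) ((2 * z) *: (- sin x)).
    by apply: is_deriveZ.
  have := @is_deriveD _ _ _ (cst (1 + y)) _ x 1 _ _ (is_derive_cst _ _ _) dc.
  by rewrite add0r /GRing.scale /= mulrN.
have F'E : derive1 mp_angle = fun x => - (2 * z * sin x).
  by apply/funext => x; rewrite derive1E (@derive_val _ _ _ _ _ _ _ (dF x)).
have cF' : continuous (fun x : R => - (2 * z * sin x)).
  move=> x; apply: cvgN; apply: cvgM; first exact: cvg_cst.
  exact: continuous_sin.
have := @integration_by_substitution_decreasing R mp_angle
   (fun x => G x * mp_root x) 0 pi (@pi_ge0 R).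
rewrite F0 Fpi F'E => -> //.
- apply: eq_integral => t; rewrite inE /= => ht; congr (_%:E).
  rewrite -[LHS]/(G (mp_angle t) * mp_root (mp_angle t) * (- - (2 * z * sin t))).
  by rewrite opprK mp_root_angle // -zz; ring.
- move=> u v hu hv uv; rewrite /mp_angle ltrD2l ltr_pM2l; last first.
    by rewrite mulr_gt0.
  by rewrite ltr_cos.
- by apply/cvg_ex; exists (- (2 * z * sin 0)); exact/cvg_at_right_filter/cF'.
- by apply/cvg_ex; exists (- (2 * z * sin pi)); exact/cvg_at_left_filter/cF'.
- split.
  + by move=> x _; have [] := dF x.
  + exact/cvg_at_right_filter/continuous_mp_angle.
  + exact/cvg_at_left_filter/continuous_mp_angle.
- move=> x; apply: continuousM; first exact: cG.
  exact: (continuous_subspaceT continuous_mp_root).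
Qed.


(** The integral of x^k p_h(x) against the semicircle, where p_h is the Chebyshev
    polynomial of the second kind, rescaled by sqrt(y)^-h so that multiplication by x
    has coefficients y, 1 + y and 1. *)
Definition mp_trig_moment k h : R :=
  2 / pi * z ^- h * int0pi (fun t => mp_angle t ^+ k * (sin t * sin (h.+1%:R * t))).

Lemma angle_sin h t : mp_angle t * sin (h.+1%:R * t) =
  (1 + y) * sin (h.+1%:R * t) + z * sin (h.+2%:R * t) + z * sin (h%:R * t).
Proof.
have -> : h%:R * t = h.+1%:R * t - t by rewrite -natr1; ring.
have -> : h.+2%:R * t = h.+1%:R * t + t by rewrite -[h.+2%:R]natr1; ring.
by rewrite sinD sinB /mp_angle; ring.
Qed.

Lemma mp_trig_moment0 h : mp_trig_moment 0 h = (h == 0%N)%:R.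
Proof.
rewrite /mp_trig_moment.
rewrite (_ : (fun t => _) = (fun t => sin t * sin (h.+1%:R * t))); last first.
  by apply/funext => t; rewrite expr0 mul1r.
rewrite int0pi_sin_sin; case: eqP => [->|_]; last by rewrite mulr0.
have := @pi_gt0 R => /lt0r_neq0 pi0.
by rewrite /= expr0 invr1 mulr1 mulrA divfK // divff // pnatr_eq0.
Qed.

Lemma mp_trig_momentS k h : mp_trig_moment k.+1 h =
  y * mp_trig_moment k h.+1 + (1 + y) * mp_trig_moment k h
  + (if h is h'.+1 then mp_trig_moment k h' else 0).
Proof.
pose f g t : R := mp_angle t ^+ k * (sin t * sin (g%:R * t)).
have cf g : continuous (f g).
  apply: continuousMR; first exact/continuousXR/continuous_mp_angle.
  by apply: continuousMR; [exact: continuous_sin|exact: continuous_sinZ].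
have cZf c g : continuous (fun t => c * f g t).
  by apply: continuousMR; [exact: continuous_cstR|exact: cf].
have step : int0pi (fun t => mp_angle t ^+ k.+1 * (sin t * sin (h.+1%:R * t))) =
    (1 + y) * int0pi (f h.+1) + z * int0pi (f h.+2) + z * int0pi (f h).
  rewrite -!int0piZ // -!int0piD //; last by apply: continuousDR; exact: cZf.
  congr int0pi; apply/funext => t; rewrite /f exprS.
  transitivity (mp_angle t ^+ k * sin t * (mp_angle t * sin (h.+1%:R * t))).
    by ring.
  by rewrite angle_sin; ring.
have z0 := lt0r_neq0 z_gt0.
rewrite /mp_trig_moment step -/(f h.+1) -/(f h.+2) -zz; move: (2 / pi) => c.
have zh0 : z ^+ h != 0 by rewrite expf_neq0.
case: h @f {cf cZf step} zh0 => [|h] f zh0.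
  have -> : int0pi (fun t => mp_angle t ^+ k * (sin t * sin (0%N%:R * t))) = 0.
    by rewrite /int0pi; under eq_Rintegral do rewrite mul0r sin0 !mulr0; rewrite Rintegral_cst // mul0r.
  by rewrite expr1; field.
have zh0' : z ^+ h != 0 by rewrite expf_neq0.
by rewrite -/(f h.+1) !exprS; field; rewrite zh0' z0.
Qed.


(** Two consecutive steps between odd heights: up-up has weight y, down-down has
    weight 1, and the two ways to come back have weights y and 1. *)
Lemma mp_trig_moment_path k h :
  mp_trig_moment k h = path_weight 1 y false k.*2.+1 h.*2.+1.
Proof.
elim: k h => [|k IHk] h.
  rewrite mp_trig_moment0 /= mulr0 add0r.
  by case: h.
rewrite mp_trig_momentS !IHk doubleS [RHS]/= -!doubleS.
case: h => [|h]; first by rewrite /= !mul1r; ring.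
by rewrite IHk doubleS /= !mul1r; ring.
Qed.

End mp_substitution.


(** * Total mass of the density *)
Section mp_mass.
Context (R : realType) (y : R).
Hypothesis y_gt0 : 0 < y.
Notation mu := (@lebesgue_measure R).

Let z := Num.sqrt y.
Let z_gt0 : 0 < z. Proof. by rewrite sqrtr_gt0. Qed.
Let zz : z * z = y. Proof. by rewrite -expr2 sqr_sqrtr ?ltW. Qed.

Section kernel.
Variable kap : R.
Hypothesis kap_gt1 : 1 < kap.
Hypothesis kap_gty : y < kap.

Let kap_gt0 : 0 < kap. Proof. exact: lt_trans kap_gt1. Qed.

Let z_lt_kap : z < kap.
Proof.
rewrite -(@ltr_pXn2r _ 2) ?nnegrE ?ltW // !expr2 zz.
by rewrite (lt_trans kap_gty) // -[ltLHS]mulr1 ltr_pM2l.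
Qed.

Let w t := mp_angle y t + (kap + y / kap - 1 - y).

Let wE t : w t = kap + y / kap + 2 * z * cos t.
Proof. by rewrite /w /mp_angle -/z; ring. Qed.

Let wmin := (kap - z) ^+ 2 / kap.

Let wmin_gt0 : 0 < wmin.
Proof. by rewrite divr_gt0 // exprn_gt0 // subr_gt0. Qed.

Let w_ge t : wmin <= w t.
Proof.
rewrite wE /wmin -subr_ge0.
have -> : kap + y / kap + 2 * z * cos t - (kap - z) ^+ 2 / kap = 2 * z * (1 + cos t).
  by rewrite -zz; field; rewrite lt0r_neq0.
by rewrite !mulr_ge0 ?(ltW z_gt0) //; have := cos_geN1 t; lra.
Qed.

Let w_gt0 t : 0 < w t. Proof. exact: lt_le_trans (w_ge t). Qed.

Let cw : continuous (fun t => (w t)^-1).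
Proof.
move=> t; apply: cvgV; first by rewrite lt0r_neq0.
by apply: continuousDR; [exact: continuous_mp_angle|exact: continuous_cstR].
Qed.

Let f h t := (w t)^-1 * (sin t * sin (h%:R * t)).

Let cf h : continuous (f h).
Proof.
apply: continuousMR => //.
by apply: continuousMR; [exact: continuous_sin|exact: continuous_sinZ].
Qed.

Let I h := int0pi (f h).


(* Multiplying the kernel by its denominator leaves an integral of sines; this is
   a second order linear recursion with characteristic roots - z / kap and
   - kap / z. *)
Let I_rec h : (kap + y / kap) * I h.+1 + z * I h.+2 + z * I h =
  if h == 0%N then pi / 2 else 0.
Proof.
have cZf c g : continuous (fun t => c * f g t).
  by apply: continuousMR; [exact: continuous_cstR|exact: cf].
rewrite -int0pi_sin_sin /I -!int0piZ // -!int0piD //; last by apply: continuousDR; exact: cZf.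
congr int0pi; apply/funext => t; rewrite /f.
transitivity ((w t)^-1 * sin t * (w t * sin (h.+1%:R * t))); last first.
  rewrite -[RHS]mulr1 -(@mulVf _ (w t)) ?lt0r_neq0 //; ring.
have ws : w t * sin (h.+1%:R * t) = (kap + y / kap) * sin (h.+1%:R * t)
    + z * sin (h.+2%:R * t) + z * sin (h%:R * t).
  by rewrite /w mulrDl angle_sin // -/z; ring.
by rewrite ws; ring.
Qed.

Let I0 : I 0 = 0.
Proof.
rewrite /I /int0pi; under eq_Rintegral do rewrite /f mul0r sin0 !mulr0.
by rewrite Rintegral_cst // mul0r.
Qed.

Let I_bound h : `|I h| <= pi / wmin.
Proof.
rewrite /I /int0pi; apply: (@le_trans _ _ (\int[mu]_(t in `[0, pi]) `|f h t|)).
  by apply: le_normr_Rintegral => //; exact: integrable_0pi.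
have -> : pi / wmin = int0pi (fun t => wmin^-1 * cos (0%:R * t)).
  by rewrite int0piZ ?int0pi_cos 1?mulrC //; exact: continuous_cosZ.
apply: le_Rintegral => //.
- apply: (@integrable_0pi _ (fun t => `|f h t|)) => t.
  by apply: cvg_norm; exact: cf.
- apply: (@integrable_0pi _ (fun t => wmin^-1 * cos (0%:R * t))).
  by apply: continuousMR; [exact: continuous_cstR|exact: continuous_cosZ].
- move=> t _; rewrite mul0r cos0 mulr1 /f normrM -[leRHS]mulr1 ler_pM //.
    rewrite ger0_norm ?invr_ge0 ?(ltW (w_gt0 t)) //.
    by rewrite lef_pV2 ?posrE.
  by rewrite normrM -[leRHS]mulr1 ler_pM // sin_max.
Qed.


(** The sequence I is bounded, so its component along the growing solution of
    [I_rec] vanishes; K below is that component, and its vanishing gives the ratio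
    of I 2 to I 1. *)
Lemma int0pi_poisson_kernel :
  int0pi (fun t => (mp_angle y t + (kap + y / kap - 1 - y))^-1 * (sin t * sin t)) = pi / (2 * kap).
Proof.
have kap0 := lt0r_neq0 kap_gt0; have z0 := lt0r_neq0 z_gt0.
pose K h := I h.+2 + z / kap * I h.+1.
have KS h : K h.+1 = - (kap / z) * K h.
  have := I_rec h.+1; rewrite /= /K => H.
  have {}H : I h.+3 = - (kap + y / kap) / z * I h.+2 - I h.+1.
    have this : z * I h.+3 = - (kap + y / kap) * I h.+2 - z * I h.+1 by lra.
    by apply: (mulfI z0); rewrite this; field; rewrite z0.
  by rewrite H -zz; field; rewrite z0 kap0.
have Kpow h : K 0 = (- (z / kap)) ^+ h * K h.
  elim: h => [|h IHh]; first by rewrite expr0 mul1r.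
  by rewrite KS IHh exprSr; field; rewrite z0 kap0.
have K0 : K 0 = 0.
  pose q := z / kap.
  have q0 : 0 <= q by rewrite divr_ge0 // ltW.
  have q1 : q < 1 by rewrite ltr_pdivrMr // mul1r.
  pose B := pi / wmin + q * (pi / wmin).
  have KB h : `|K 0| <= q ^+ h * B.
    rewrite (Kpow h) normrM normrX normrN (ger0_norm q0) ler_wpM2l ?exprn_ge0 //.
    apply: le_trans (ler_normD _ _) _; apply: lerD; first exact: I_bound.
    by rewrite normrM (ger0_norm q0) ler_wpM2l.
  apply/eqP; rewrite -normr_le0.
  have H : q ^+ h * B @[h --> \oo] --> (0 * B : R).
    by apply: cvgM; [apply: cvg_expr; rewrite ger0_norm|exact: cvg_cst].
  rewrite mul0r in H.
  by apply: (cvgr_to_ge H); apply: nearW => h; exact: KB.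
have e : (fun t => (mp_angle y t + (kap + y / kap - 1 - y))^-1 * (sin t * sin t)) = f 1%N.
  by apply/funext => t; rewrite /f mul1r.
rewrite e -/(I 1).
have := I_rec 0; rewrite I0 /= mulr0 addr0.
have -> : I 2 = - (z / kap) * I 1 by move: K0; rewrite /K => /eqP; rewrite addr_eq0 mulNr => /eqP.
have -> : (kap + y / kap) * I 1 + z * (- (z / kap) * I 1) = kap * I 1.
  by rewrite -zz; field.
move/(congr1 (fun x => kap^-1 * x)); rewrite mulKf // => ->.
by move: (pi : R) => q; field.
Qed.

End kernel.

End mp_mass.

Section mp_moments.
Context (R : realType) (y : R).
Hypothesis y_gt0 : 0 < y.
Notation mu := (@lebesgue_measure R).
Notation a := (mp_left y).
Notation b := (mp_right y).

Let mp_ge0 x : x \in `[a, b] -> 0 <= x.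
Proof. by rewrite in_itv /= => /andP[ax _]; exact: le_trans (mp_left_ge0 y) ax. Qed.


(** At x = 0 the factor 1/x is 0 by convention; the right-hand side vanishes as
    well, 0 being then the left end of the support. *)
Lemma mul_mp_density x : x \in `[a, b] ->
  x * mp_density y x = (2 * pi * y)^-1 * mp_root y x.
Proof.
move=> xab; have := xab; rewrite in_itv /= /mp_density => /andP[ax xb].
rewrite ax xb /=; have [x0|x0] := eqVneq x 0; last first.
  have -> : 2 * pi * x * y = 2 * pi * y * x by ring.
  by rewrite invfM /mp_root; move: ((2 * pi * y)^-1) => c; field.
have a0 : a = 0 by apply/eqP; rewrite eq_le mp_left_ge0 andbT -x0.
by rewrite x0 mul0r /mp_root a0 subrr mulr0 sqrtr0 mulr0.
Qed.

Lemma mp_density_out x : x \notin `[a, b] -> mp_density y x = 0.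
Proof. by rewrite in_itv /= /mp_density => /negPf ->. Qed.

Lemma integral_mp_angle (G : R -> R) :
  (forall x, x \in `[a, b] -> {for x, continuous G}) ->
  (forall t, {for t, continuous (fun t => G (mp_angle y t))}) ->
  (\int[mu]_(x in `[a, b]) (G x * ((2 * pi * y)^-1 * mp_root y x))%:E
   = (2 / pi * int0pi (fun t => G (mp_angle y t) * (sin t * sin t)))%:E)%E.
Proof.
move=> cG cGt.
have cG' : {within `[a, b], continuous G}.
  by apply: continuous_in_subspaceT => x; rewrite inE; exact: cG.
have ci : continuous (fun t => G (mp_angle y t) * (sin t * sin t)).
  by apply: continuousMR => //; apply: continuousMR; exact: continuous_sin.
transitivity (\int[mu]_(x in `[a, b]) ((2 * pi * y)^-1%:E * (G x * mp_root y x)%:E))%E.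
  by apply: eq_integral => x _; rewrite -EFinM; congr (_%:E); ring.
have iG : mu.-integrable `[a, b] (EFin \o (fun x => G x * mp_root y x)).
  apply: continuous_compact_integrable; first exact: segment_compact.
  move=> x; apply: continuousM; first exact: cG'.
  exact: (continuous_subspaceT (@continuous_mp_root _ y)).
rewrite integralZl // mp_substitution //.
transitivity ((2 * pi * y)^-1%:E * \int[mu]_(t in `[0%R, pi])
    ((4 * y)%:E * (G (mp_angle y t) * (sin t * sin t))%:E))%E.
  by congr (_ * _)%E; apply: eq_integral => t _; rewrite -EFinM; congr (_%:E); ring.
rewrite integralZl //; last exact: integrable_0pi.
rewrite /int0pi /Rintegral [RHS]EFinM fineK; last first.
  by apply: integrable_fin_num => //; exact: integrable_0pi.
rewrite muleA -EFinM; congr (_%:E * _)%E.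
have := lt0r_neq0 (@pi_gt0 R); move: (pi : R) => q q0.
by field; rewrite q0 lt0r_neq0.
Qed.

Lemma integral_mp_densityS k :
  (\int[mu]_(x in `[a, b]) (x ^+ k.+1 * mp_density y x)%:E =
   (path_weight 1 y true k.+1.*2 0)%:E)%E.
Proof.
transitivity (\int[mu]_(x in `[a, b])
    ((x ^+ k) * ((2 * pi * y)^-1 * mp_root y x))%:E)%E.
  by apply: eq_integral => x; rewrite inE => xab; rewrite exprSr -mulrA mul_mp_density.
rewrite (integral_mp_angle (G := fun x => x ^+ k)); first last.
- by move=> t; apply: continuousXR; exact: continuous_mp_angle.
- by move=> x _; exact: exprn_continuous.
congr (_%:E); transitivity (mp_trig_moment y k 0).
  rewrite /mp_trig_moment expr0 invr1 mulr1; congr (_ * int0pi _).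
  by apply/funext => t; rewrite mul1r.
by rewrite mp_trig_moment_path // doubleS /= mul1r addr0.
Qed.


(** The factor 1/x of the density is regularized to 1/(x + eps), which gives a
    Poisson kernel of parameter kap with kap + y / kap = 1 + y + eps and value
    1 / kap.  Letting kap decrease to max(1, y) makes eps decrease to 0, and
    monotone convergence applies whether or not the support reaches 0. *)
Lemma integral_mp_density :
  (\int[mu]_(x in `[a, b]) (mp_density y x)%:E = ((Num.max 1 y)^-1)%:E)%E.
Proof.
pose M := Num.max 1 y.
have M1 : 1 <= M by rewrite le_max lexx.
have My : y <= M by rewrite le_max lexx orbT.
have M0 : 0 < M by exact: lt_le_trans M1.
pose kap n : R := M + n.+1%:R^-1.
have kapM n : M < kap n by rewrite ltrDl invr_gt0.
have kap1 n : 1 < kap n by exact: le_lt_trans (kapM n).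
have kapy n : y < kap n by exact: le_lt_trans (kapM n).
have kap0 n : 0 < kap n by exact: lt_trans (kap1 n).
pose eps n := kap n + y / kap n - 1 - y.
have eps0 n : 0 < eps n.
  have -> : eps n = (kap n - 1) * (kap n - y) / kap n.
    by rewrite /eps; field; rewrite lt0r_neq0.
  by rewrite divr_gt0 // mulr_gt0 // subr_gt0.
have nd_kap m n : (m <= n)%N -> kap n <= kap m.
  by move=> mn; rewrite lerD2l lef_pV2 ?posrE // ler_nat ltnS.
have nd_eps m n : (m <= n)%N -> eps n <= eps m.
  move=> /nd_kap h; rewrite -subr_ge0.
  have -> : eps m - eps n = (kap m - kap n) * (kap m * kap n - y) / (kap m * kap n).
    by rewrite /eps; field; rewrite !lt0r_neq0.
  apply: divr_ge0; last by rewrite mulr_ge0 // ltW.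
  apply: mulr_ge0; rewrite subr_ge0 //.
  by rewrite (le_trans (ltW (kapy m))) // -[leLHS]mulr1 ler_wpM2l // ltW.
have cvg_kap : kap n @[n --> \oo] --> M.
  by rewrite -[X in _ --> X]addr0; apply: cvgD; [exact: cvg_cst|exact: cvg_harmonic].
have M1y : M + y / M - 1 - y = 0.
  by rewrite /M; case: (leP 1 y) => h; field; rewrite ?oner_eq0 ?lt0r_neq0.
have cvg_eps : eps n @[n --> \oo] --> (0 : R).
  rewrite -M1y; apply: cvgB; last exact: cvg_cst.
  apply: cvgB; last exact: cvg_cst.
  apply: cvgD => //; apply: cvgM; first exact: cvg_cst.
  by apply: cvgV => //; rewrite lt0r_neq0.
pose g n x := (x / (x + eps n) * mp_density y x)%:E.
have int_g n : (\int[mu]_(x in `[a, b]) g n x = ((kap n)^-1)%:E)%E.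
  transitivity (\int[mu]_(x in `[a, b])
      ((x + eps n)^-1 * ((2 * pi * y)^-1 * mp_root y x))%:E)%E.
    apply: eq_integral => x; rewrite inE => xab.
    by rewrite -mul_mp_density // mulrA [_ * x]mulrC.
  rewrite (integral_mp_angle (G := fun x => (x + eps n)^-1)); first last.
  - move=> t; apply: cvgV.
      rewrite lt0r_neq0 // ltr_wpDl //.
      have : mp_angle y t \in `[a, b].
        rewrite in_itv /= mp_leftE // mp_rightE // /mp_angle.
        have s0 : 0 <= Num.sqrt y by exact: sqrtr_ge0.
        have := cos_geN1 t; have := cos_le1 t => c1 c2.
        by apply/andP; split; nra.
      exact: mp_ge0.
    apply: cvgD; last exact: cvg_cst.
    exact: continuous_mp_angle.
  - move=> x /mp_ge0 x0; apply: cvgV; first by rewrite lt0r_neq0 // ltr_wpDl.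
    by apply: cvgD; [exact: cvg_id|exact: cvg_cst].
  congr (_%:E); rewrite (int0pi_poisson_kernel y_gt0 (kap1 n) (kapy n)).
  have := lt0r_neq0 (@pi_gt0 R); move: (pi : R) => q q0.
  by field; rewrite q0 lt0r_neq0.
have lim_g x : x \in `[a, b] -> limn (g ^~ x) = (mp_density y x)%:E.
  move=> xab; apply/cvg_lim => //; rewrite /g.
  have [x0|x0] := eqVneq x 0.
    rewrite x0 (_ : mp_density y 0 = 0).
      by under eq_fun do rewrite mulr0; exact: cvg_cst.
    by rewrite /mp_density mulr0 mul0r invr0 mul0r; case: ifP.
  apply/fine_cvgP; split; first exact: nearW.
  rewrite -[X in _ --> X]mul1r; apply: cvgM; last exact: cvg_cst.
  rewrite -(divff x0); apply: cvgM; first exact: cvg_cst.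
  apply: cvgV => //; rewrite -[X in _ --> X]addr0.
  by apply: cvgD; [exact: cvg_cst|exact: cvg_eps].
have mg n : measurable_fun `[a, b] (g n).
  apply/measurable_EFinP; apply: measurable_funM; last first.
    by apply: measurable_funTS; exact: measurable_mp_density.
  apply: subspace_continuous_measurable_fun => //.
  apply: continuous_in_subspaceT => x; rewrite inE => /mp_ge0 x0.
  apply: cvgM; first exact: cvg_id.
  apply: cvgV; first by rewrite lt0r_neq0 // ltr_wpDl.
  by apply: cvgD; [exact: cvg_id|exact: cvg_cst].
have cvg_int : (\int[mu]_(x in `[a, b]) g n x @[n --> \oo] -->
    \int[mu]_(x in `[a, b]) (mp_density y x)%:E)%E.
  have -> : (\int[mu]_(x in `[a, b]) (mp_density y x)%:E =
      \int[mu]_(x in `[a, b]) limn (g ^~ x))%E.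
    by apply: eq_integral => x; rewrite inE => /lim_g.
  apply: cvg_monotone_convergence => //.
  - move=> n x /mp_ge0 x0; rewrite lee_fin mulr_ge0 ?mp_density_ge0 //.
    by rewrite divr_ge0 // addr_ge0 // ltW.
  - move=> x /mp_ge0 x0 m n mn; rewrite lee_fin ler_wpM2r ?mp_density_ge0 //.
    have xe k : 0 < x + eps k by rewrite ltr_wpDl.
    apply: ler_wpM2l => //; rewrite lef_pV2 ?posrE //.
    by rewrite lerD2l nd_eps.
have cvg_int' : (\int[mu]_(x in `[a, b]) g n x @[n --> \oo] --> (M^-1)%:E)%E.
  under eq_fun do rewrite int_g.
  apply/fine_cvgP; split; first exact: nearW.
  by apply: cvgV => //; rewrite lt0r_neq0.
by move/cvg_unique: cvg_int; apply.
Qed.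

End mp_moments.


(** * Moments of the Marchenko-Pastur law *)
Section mp_measure.
Context (R : realType) (y : R).
Hypothesis y_gt0 : 0 < y.
Notation mu := (@lebesgue_measure R).
Notation a := (mp_left y).
Notation b := (mp_right y).
Notation mp := (marchenko_pastur y).

Let atom : R := 1 - (Num.max 1 y)^-1.

Let atom_ge0 : 0 <= atom.
Proof. by rewrite subr_ge0 invf_le1 ?le_max ?lexx // lt_max ltr01. Qed.

Let atomP : {nonneg R} := NngNum atom_ge0.

Let mpE A : mp A = measure_add (mscale atomP \d_(0%R : R)) (mp_ac y) A.
Proof.
rewrite measure_addE /marchenko_pastur.
transitivity (atom%:E * \d_(0%R : R) A + mp_ac y A)%E => //.
rewrite /atom; case: ltP => // y1.
by rewrite invr1 subrr mul0e add0e.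
Qed.

Lemma ge0_integral_marchenko_pastur (f : R -> R) :
  measurable_fun setT f -> (forall x, 0 <= f x) ->
  (\int[mp]_x (f x)%:E = (atom * f 0)%:E +
     \int[mu]_(x in `[a, b]) (f x * mp_density y x)%:E)%E.
Proof.
move=> mf f0.
have mfE : measurable_fun setT (fun x => (f x)%:E) by exact/measurable_EFinP.
have f0E x : setT x -> (0 <= (f x)%:E)%E by rewrite lee_fin.
rewrite (eq_measure_integral (measure_add (mscale atomP \d_(0%R : R)) (mp_ac y))); last first.
  by move=> A _ _; exact: mpE.
rewrite ge0_integral_measure_add //; congr (_ + _)%E.
  rewrite ge0_integral_mscale // integral_dirac //.
  by rewrite diracT mul1e -EFinM.
have <- : (\int[mu]_x (f x * mp_density y x)%:E = \int[mp_ac y]_x (f x)%:E)%E.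
  by apply: ge0_integral_density => //;
    [exact: measurable_mp_density | exact: mp_density_ge0].
rewrite [RHS]integral_mkcond; apply: eq_integral => x _.
rewrite /patch; case: ifPn => //; rewrite notin_setE /= => xab.
by rewrite mp_density_out ?mulr0 //; apply/negP.
Qed.

Lemma marchenko_pastur_support : mp (~` `[0, b]) = 0%E.
Proof.
rewrite mpE measure_addE.
transitivity (atom%:E * \d_(0%R : R) (~` `[0%R, b]) + mp_ac y (~` `[0%R, b]))%E => //.
have -> : mp_ac y (~` `[0, b]) = 0%E.
  rewrite /mp_ac; apply: integral0_eq => x /= xb.
  rewrite mp_density_out //; apply/negP; rewrite in_itv /= => /andP[ax xb'].
  by apply: xb; rewrite /= in_itv /= xb' andbT (le_trans (mp_left_ge0 y)).
rewrite adde0 diracE memNset ?mule0 //= => h; apply: h.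
by rewrite /= in_itv /= lexx ltW // mp_right_gt0.
Qed.

Let m k : R := path_weight 1 y true k.*2 0.


(* A nonnegative function that agrees with x^k on the support; the formula for the
   integral is available for nonnegative functions only. *)
Let posX k (x : R) : R := (Num.max x 0) ^+ k.

Let measurable_posX k : measurable_fun setT (posX k).
Proof. by apply: measurable_funX; exact: measurable_maxr. Qed.

Let posX_ge0 k x : 0 <= posX k x.
Proof. by rewrite exprn_ge0 // le_max lexx orbT. Qed.

Let integral_posX k : (\int[mp]_x (posX k x)%:E = (m k)%:E)%E.
Proof.
rewrite ge0_integral_marchenko_pastur //.
have -> : (\int[mu]_(x in `[a, b]) (posX k x * mp_density y x)%:E =
           \int[mu]_(x in `[a, b]) (x ^+ k * mp_density y x)%:E)%E.
  apply: eq_integral => x; rewrite inE /= in_itv /= => /andP[ax _].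
  by rewrite /posX max_l // (le_trans (mp_left_ge0 y)).
case: k => [|k]; last first.
  rewrite integral_mp_densityS // /posX maxxx expr0n /= mulr0.
  by rewrite add0e.
under eq_integral do rewrite expr0 mul1r.
by rewrite integral_mp_density // /posX expr0 mulr1 -EFinD /atom subrK.
Qed.

Let ae_posX k : ae_eq mp setT (fun x => (x ^+ k)%:E) (fun x => (posX k x)%:E).
Proof.
exists (~` `[0, b]); split.
- exact: measurableC.
- exact: marchenko_pastur_support.
- move=> x /= h xb; apply: h => _; move: xb; rewrite /= in_itv /= => /andP[x0 _].
  by rewrite /posX max_l.
Qed.

Let measurable_EX k : measurable_fun (setT : set R) (fun x => (x ^+ k)%:E).
Proof. by apply/measurable_EFinP; exact: exprn_measurable. Qed.

Theorem marchenko_pastur_moments k : (\int[mp]_x (x ^+ k)%:E = (m k)%:E)%E.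
Proof.
rewrite -integral_posX; apply: ae_eq_integral => //.
exact/measurable_EFinP.
Qed.

Lemma integrable_marchenko_pasturX k : mp.-integrable setT (fun x : R => (x ^+ k)%:E).
Proof.
apply/integrableP; split => //.
rewrite (_ : (\int[mp]_x `|(x ^+ k)%:E|)%E = (m k)%:E)%E ?ltry //.
rewrite -integral_posX; apply: ae_eq_integral => //.
- exact: measurableT_comp.
- exact/measurable_EFinP.
- exists (~` `[0, b]); split.
  + exact: measurableC.
  + exact: marchenko_pastur_support.
  + move=> x /= h xb; apply: h => _; move: xb; rewrite /= in_itv /= => /andP[x0 _].
    by rewrite /posX max_l // ger0_norm // exprn_ge0.
Qed.

Lemma marchenko_pastur_setT : mp setT = 1%E.
Proof.
have := marchenko_pastur_moments 0; rewrite /m /= => <-.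
by rewrite -[LHS]mul1e -integral_cst //; apply: eq_integral => x _.
Qed.

End mp_measure.


(** * Spectrum of a real symmetric matrix *)
Section symmetric_spectrum.

Lemma char_poly_conj (F : comUnitRingType) n (Q D : 'M[F]_n) : Q \in unitmx ->
  char_poly (invmx Q *m D *m Q) = char_poly D.
Proof.
move=> uQ; pose L M : 'M[{poly F}]_n := map_mx polyC M.
have QQ : L (invmx Q) *m L Q = 1%:M by rewrite -map_mxM mulVmx // map_mx1.
have -> : char_poly (invmx Q *m D *m Q) = \det (L (invmx Q) *m char_poly_mx D *m L Q).
  congr (\det _); rewrite /char_poly_mx !map_mxM mulmxBr mulmxBl; congr (_ - _).
  by rewrite mul_mx_scalar -scalemxAl QQ scalemx1.
by rewrite !det_mulmx mulrAC -det_mulmx QQ det1 mul1r.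
Qed.

Lemma mxtrace_conjX (F : comUnitRingType) n (Q D : 'M[F]_n) k : Q \in unitmx ->
  \tr ((invmx Q *m D *m Q) ^+ k) = \tr (D ^+ k).
Proof.
move=> uQ; have -> : (invmx Q *m D *m Q) ^+ k = invmx Q *m D ^+ k *m Q.
  elim: k => [|k IHk]; first by rewrite !expr0 mulmx1 mulVmx.
  by rewrite !exprS IHk -!mulmxE !mulmxA mulmxK.
by rewrite mxtrace_mulC mulmxA mulmxV // mul1mx.
Qed.

Lemma mxtrace_diagX (F : comNzRingType) n (v : 'rV[F]_n) k :
  \tr (diag_mx v ^+ k) = \sum_i v 0 i ^+ k.
Proof.
have -> : diag_mx v ^+ k = diag_mx (\row_i v 0 i ^+ k).
  elim: k => [|k IHk].
    rewrite expr0; apply/matrixP => i j; rewrite !mxE expr0.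
    by case: eqP.
  rewrite exprS IHk -mulmxE mulmx_diag; congr diag_mx.
  by apply/rowP => i; rewrite !mxE exprS.
by rewrite mxtrace_diag; apply: eq_bigr => i _; rewrite mxE.
Qed.

Variables (R : realType) (p : nat) (A : 'M[R]_p).
Hypothesis A_sym : A^T = A.

Let c := real_complex R.
Let cA : 'M[R[i]]_p := map_mx c A.

Let cA_normal : cA \is hermsymmx.
Proof.
apply/is_hermitianmxP; rewrite expr0 scale1r; apply/matrixP => i j.
rewrite !mxE -[in LHS]A_sym mxE; apply/esym/CrealP/complex_realP.
by exists (A j i).
Qed.


(** The complexified matrix is Hermitian, hence unitarily diagonalizable with real
    eigenvalues; the identities then descend to the reals by injectivity. *)
Lemma symmetric_spectrum : exists v : 'rV[R]_p,
  char_poly A = \prod_i ('X - (v 0 i)%:P) /\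
  forall k, \tr (A ^+ k) = \sum_i v 0 i ^+ k.
Proof.
have /hermitian_normalmx/orthomx_spectralP := cA_normal.
have uS := spectral_unit cA; have rD := hermitian_spectral_diag_real cA_normal.
move: (spectralmx cA) (spectral_diag cA) uS rD => S D uS rD cAE.
pose v : 'rV[R]_p := \row_i complex.Re (D 0 i).
have vE i : c (v 0 i) = D 0 i by rewrite mxE; apply: RRe_real; exact: (mxOverP rD).
exists v; split.
  apply: (@map_poly_inj _ _ c); rewrite map_char_poly -/cA cAE char_poly_conj //.
  rewrite char_poly_trig ?diag_mx_is_trig // map_prod_XsubC.
  apply: eq_bigr => i _; rewrite mxE eqxx mulr1n; congr (_ - _%:P).
  exact: (esym (vE i)).
move=> k; apply: (@complexI R); transitivity (\tr (map_mx c (A ^+ k))).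
  exact: esym (trace_map_mx _ _).
have -> : map_mx c (A ^+ k) = cA ^+ k.
  elim: k => [|k IHk]; first by rewrite !expr0 map_mx1.
  by rewrite !exprS -!mulmxE map_mxM IHk.
rewrite cAE mxtrace_conjX // mxtrace_diagX rmorph_sum /=.
by apply: eq_bigr => i _; rewrite rmorphXn; congr (_ ^+ _); exact: esym (vE i).
Qed.

Lemma eigenvalues_symmetric :
  size (eigenvalues A) = p /\
  forall k, \tr (A ^+ k) = \sum_(l <- eigenvalues A) l ^+ k.
Proof.
have [v [Av trA]] := symmetric_spectrum.
pose s := [seq v 0 i | i <- enum 'I_p].
have As : char_poly A = \prod_(l <- s) ('X - l%:P) by rewrite Av big_map big_enum.
have : perm_eq (eigenvalues A) s.
  apply: prod_XsubC_eq; rewrite -As /eigenvalues.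
  have := @xgetI _ [::] [set s | char_poly A = \prod_(l <- s) ('X - l%:P)] s As.
  by move=> /= <-.
move=> e; split; first by rewrite (perm_size e) size_map size_enum_ord.
by move=> k; rewrite trA (perm_big _ e) big_map big_enum.
Qed.

End symmetric_spectrum.


(** * Polynomial majorants of the indicator of a half-line *)
Section threshold_polynomial.
Context (R : realType).

Lemma bernoulli_ge (w : R) M : 0 <= w -> 1 + M%:R * w <= (1 + w) ^+ M.
Proof.
move=> w0; elim: M => [|M IHM]; first by rewrite mul0r addr0 expr0.
rewrite exprS -natr1; have M0 : 0 <= M%:R :> R by [].
have := ler_wpM2l (_ : 0 <= 1 + w) IHM; rewrite addr_ge0 // => /(_ isT).
by apply: le_trans; nra.
Qed.

Lemma bernoulli_le (v : R) M : 0 <= v <= 1 -> 1 - M%:R * v <= (1 - v) ^+ M.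
Proof.
move=> /andP[v0 v1]; elim: M => [|M IHM]; first by rewrite mul0r subr0 expr0.
rewrite exprS -natr1; have M0 : 0 <= M%:R :> R by [].
have := ler_wpM2l (_ : 0 <= 1 - v) IHM; rewrite subr_ge0 v1 => /(_ isT).
by apply: le_trans; nra.
Qed.


(** With M = 2m, the power (1 - v)^M is at least 1 - M v and at most 1 / (1 + M v).
    It remains to choose M between the inverses of al^2n and be^2n, which are far
    apart for large n.  Even exponents make the polynomial nonnegative everywhere. *)
Lemma sharp_threshold (al be e : R) : 0 < al -> al < 1 -> al < be -> 0 < e ->
  exists n m, 1 - e <= (1 - al ^+ n.*2) ^+ m.*2 /\
    forall u, be <= u -> u <= 1 -> (1 - u ^+ n.*2) ^+ m.*2 <= e.
Proof.
move=> al0 al1 albe e0; have be0 : 0 < be by exact: lt_trans albe.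
pose A := al ^+ 2; pose B := be ^+ 2.
have A0 : 0 < A by rewrite exprn_gt0.
have B0 : 0 < B by rewrite exprn_gt0.
have A1 : A < 1 by rewrite /A expr_lt1 // ltW.
have AB : A / B < 1.
  by rewrite ltr_pdivrMr // mul1r /A /B ltr_pXn2r // ?nnegrE ltW.
have lim0 : (2 / e * (A / B) ^+ n + 2 * A ^+ n) @[n --> \oo] --> (0 : R).
  rewrite -[X in _ --> X](_ : 2 / e * 0 + 2 * 0 = 0); last by ring.
  apply: cvgD; apply: cvgM; try exact: cvg_cst; apply: cvg_expr.
    by rewrite ger0_norm // divr_ge0 ?ltW.
  by rewrite ger0_norm // ltW.
have [n hn] : exists n, 2 / e * (A / B) ^+ n + 2 * A ^+ n < e.
  have [N _ HN] := cvgr_lt _ lim0 _ e0.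
  by exists N; apply: HN => /=.
pose r := (e * B ^+ n)^-1.
have Bn0 : 0 < B ^+ n by rewrite exprn_gt0.
have r0 : 0 < r by rewrite invr_gt0 mulr_gt0.
have /andP[r1 r2] := truncn_itv (ltW r0).
pose M := (Num.truncn r).+1.
have ME : M.*2%:R = 2 * M%:R :> R by rewrite -mul2n natrM.
exists n, M; split.
  rewrite -mul2n exprM -/A.
  have An : 0 <= A ^+ n <= 1 by rewrite exprn_ge0 ?exprn_ile1 // ltW.
  apply: le_trans (bernoulli_le _ An); rewrite lerD2l lerN2 ME.
  apply: le_trans (ltW hn); have Mr : M%:R <= r + 1 by rewrite /M -natr1 lerD2r.
  have -> : 2 / e * (A / B) ^+ n + 2 * A ^+ n = 2 * (r + 1) * A ^+ n.
    by rewrite /r expr_div_n; field; rewrite !lt0r_neq0.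
  by apply: ler_wpM2r; [rewrite exprn_ge0 // ltW | exact: ler_wpM2l].
move=> u ube u1; rewrite -mul2n exprM; set w := (u ^+ 2) ^+ n.
have u0 : 0 < u by exact: lt_le_trans ube.
have w0 : 0 < w by rewrite !exprn_gt0.
have wB : B ^+ n <= w.
  apply: lerXn2r; rewrite ?nnegrE ?(ltW B0) ?exprn_ge0 ?(ltW u0) //.
  by apply: lerXn2r; rewrite ?nnegrE ?(ltW be0) ?(ltW u0).
have w1 : w <= 1 by rewrite !exprn_ile1 ?exprn_ge0 ?(ltW u0).
have h1 : (1 - w) ^+ M.*2 * (1 + w) ^+ M.*2 <= 1.
  rewrite -exprMn expr_le1 //; nra.
have h2 : e^-1 <= (1 + w) ^+ M.*2.
  apply: le_trans (bernoulli_ge _ (ltW w0)); rewrite ME.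
  apply: (@le_trans _ _ (M%:R * B ^+ n)).
    have -> : e^-1 = r * B ^+ n by rewrite /r; field; rewrite !lt0r_neq0.
    by rewrite ler_wpM2r ?ltW.
  have : M%:R * B ^+ n <= M%:R * w by rewrite ler_wpM2l.
  have : 0 <= M%:R * w by rewrite mulr_ge0 // ltW.
  by lra.
have h3 : 0 <= (1 - w) ^+ M.*2 by rewrite exprn_ge0 // subr_ge0.
have : (1 - w) ^+ M.*2 * e^-1 <= 1 by apply: le_trans h1; rewrite ler_wpM2l.
by rewrite ler_pdivrMr // mul1r.
Qed.


(** A translate of the polynomial of [sharp_threshold], centred at a point -K far
    to the left, handles t >= -K; the even power of t / K handles t < -K and is
    negligible on [-B, B]. *)
Lemma threshold_poly (x x' B e : R) : x < x' -> 0 < e ->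
  exists q : {poly R}, (forall t, (t <= x)%R%:R <= q.[t]) /\
    (forall t, `|t| <= B -> q.[t] <= (t <= x')%R%:R + e).
Proof.
move=> xx' e0.
pose K := Num.max `|B| `|x| + 1.
have BK : B < K by rewrite ltr_pwDr // (le_trans (ler_norm B)) // le_max lexx.
have BK' : `|B| < K by rewrite ltr_pwDr // le_max lexx.
have xK : `|x| < K by rewrite ltr_pwDr // le_max lexx orbT.
have K0 : 0 < K by exact: le_lt_trans xK.
clearbody K.
have [xK1 xK2] : - K < x /\ x < K by move: xK; rewrite ltr_norml => /andP[].
pose al := (x + K) / (2 * K); pose be := (x' + K) / (2 * K).
have DK : 0 < 2 * K by rewrite mulr_gt0.
have al0 : 0 < al by rewrite divr_gt0 //; lra.
have al1 : al < 1 by rewrite ltr_pdivrMr //; lra.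
have albe : al < be by rewrite ltr_pM2r ?invr_gt0 //; lra.
pose d := Num.min 2^-1 (e / 3).
have d0 : 0 < d by rewrite lt_min invr_gt0 ltr0n divr_gt0.
have d2 : d <= 2^-1 by rewrite ge_min lexx.
have d3 : 3 * d <= e.
  have : d <= e / 3 by rewrite ge_min lexx orbT.
  by lra.
have [n [m [h1 h2]]] := sharp_threshold al0 al1 albe d0.
have [j hj] : exists j, (`|B| / K) ^+ j.*2 < d.
  have Bq : `|B| / K < 1 by rewrite ltr_pdivrMr // mul1r.
  have Bq0 : 0 <= `|B| / K by rewrite divr_ge0 // ltW.
  have lim0 : ((`|B| / K) ^+ 2) ^+ j @[j --> \oo] --> (0 : R).
    apply: cvg_expr; rewrite ger0_norm ?exprn_ge0 // expr_lt1 //.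
  have [N _ HN] := cvgr_lt _ lim0 _ d0.
  by exists N; rewrite -mul2n exprM; apply: HN => /=.
pose u t : R := (t + K) / (2 * K).
pose q : {poly R} := (1 - d)^-1 *: (1 - ((2 * K)^-1 *: ('X + K%:P)) ^+ n.*2) ^+ m.*2
   + (K^-1 *: 'X) ^+ j.*2.
have qE t : q.[t] = (1 - d)^-1 * (1 - u t ^+ n.*2) ^+ m.*2 + (t / K) ^+ j.*2.
  by rewrite /q !hornerE /u [(t + K) / _]mulrC [t / _]mulrC.
have ev0 (a : R) k : 0 <= a ^+ k.*2 by rewrite -mul2n exprM exprn_ge0 // sqr_ge0.
have d1 : 0 < 1 - d by lra.
have ge0 t : 0 <= q.[t] by rewrite qE addr_ge0 // mulr_ge0 // invr_ge0 ltW.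
exists q; split=> t.
  case: (leP t x) => tx //=; rewrite qE.
  have [tK|tK] := leP (- K) t.
    rewrite -[leLHS]addr0 lerD //.
    rewrite -[leLHS](mulVf (lt0r_neq0 d1)); apply: ler_wpM2l; first by rewrite invr_ge0 ltW.
    apply: (le_trans h1).
    have u0 : 0 <= u t by rewrite divr_ge0 ?(ltW DK) //; lra.
    have ual : u t <= al by rewrite ler_pM2r ?invr_gt0 //; lra.
    have up : u t ^+ n.*2 <= al ^+ n.*2 by rewrite lerXn2r ?nnegrE // ltW.
    have al1' : al ^+ n.*2 <= 1 by rewrite exprn_ile1 ?(ltW al0) ?(ltW al1).
    by apply: lerXn2r; rewrite ?nnegrE; lra.
  rewrite -[leLHS]add0r lerD ?mulr_ge0 ?invr_ge0 ?(ltW d1) //.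
  rewrite -(expr1n _ j.*2) -[leRHS]ger0_norm ?ev0 // normrX.
  apply: lerXn2r; rewrite ?nnegrE ?normr_ge0 //.
  by rewrite normrM normfV (gtr0_norm K0) ler_pdivlMr // mul1r ltr0_norm; lra.
move=> tB; have [tB1 tB2] : - `|B| <= t /\ t <= `|B|.
  by have := le_trans tB (ler_norm B); rewrite ler_norml => /andP[].
have u0 : 0 <= u t by rewrite divr_ge0 ?(ltW DK) //; lra.
have u1 : u t <= 1 by rewrite ler_pdivrMr //; lra.
have un0 : 0 <= u t ^+ n.*2 by [].
have un1 : u t ^+ n.*2 <= 1 by rewrite exprn_ile1.
have tail : (t / K) ^+ j.*2 <= d.
  apply: le_trans (ltW hj); rewrite -[leLHS]ger0_norm ?ev0 // normrX.
  apply: lerXn2r; rewrite ?nnegrE ?normr_ge0 ?divr_ge0 ?(ltW K0) //.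
  rewrite normrM normfV (gtr0_norm K0) ler_pM2r ?invr_gt0 //.
  by rewrite ler_norml tB1.
have inv_d : (1 - d)^-1 <= 1 + 2 * d.
  by rewrite -[leLHS]mul1r ler_pdivrMr //; nra.
rewrite qE; case: (leP t x') => tx' /=.
  have p1 : (1 - u t ^+ n.*2) ^+ m.*2 <= 1 by apply: exprn_ile1; lra.
  have : (1 - d)^-1 * (1 - u t ^+ n.*2) ^+ m.*2 <= (1 - d)^-1.
    by rewrite -[leRHS]mulr1 ler_wpM2l // invr_ge0 ltW.
  by lra.
have p2 : (1 - u t ^+ n.*2) ^+ m.*2 <= d.
  by apply: h2 => //; rewrite ler_pM2r ?invr_gt0 //; lra.
have : (1 - d)^-1 * (1 - u t ^+ n.*2) ^+ m.*2 <= (1 - d)^-1 * d.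
  by rewrite ler_wpM2l // invr_ge0 ltW.
have : (1 - d)^-1 * d <= 2 * d.
  by rewrite ler_wpM2r ?(ltW d0) //; lra.
by lra.
Qed.

End threshold_polynomial.


(** * From convergence of moments to weak convergence *)

(** Monotonicity needs no measurability, the integral of a nonnegative function
    being a supremum over simple functions.  It thus applies to the empirical
    spectral distribution without a study of how eigenvalues depend on the matrix. *)
Lemma ge0_le_integralT d (T : measurableType d) (R : realType)
    (mu : {measure set T -> \bar R}) (f g : T -> \bar R) :
  (forall t, 0 <= f t)%E -> (forall t, f t <= g t)%E ->
  (\int[mu]_t f t <= \int[mu]_t g t)%E.
Proof.
move=> f0 fg; have g0 t : (0 <= g t)%E := le_trans (f0 t) (fg t).
rewrite !ge0_integralTE //; apply: le_ereal_sup => _ [h hf <-].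
by exists h => // t; exact: le_trans (hf t) (fg t).
Qed.

Section esd_polynomials.
Context (R : realType).

Lemma esd_sum p (A : 'M[R]_p) x : A^T = A ->
  esd A x = p%:R^-1 * \sum_(l <- eigenvalues A) (l <= x)%R%:R.
Proof.
move=> symA; have [szA _] := eigenvalues_symmetric symA.
rewrite /esd /distribution_function.
transitivity (fine ((p%:R^-1)%:E *
    (\sum_(0 <= k < p) \d_((eigenvalues A)`_k) `]-oo, x]%classic : \bar R))%E).
  by congr (fine (_ * _)%E); rewrite big_mkord.
have -> : (\sum_(0 <= k < p) \d_((eigenvalues A)`_k) `]-oo, x]%classic =
    (\sum_(l <- eigenvalues A) (l <= x)%R%:R)%:E :> \bar R)%E.
  rewrite -sumEFin [RHS](big_nth 0) szA; apply: eq_bigr => k _.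
  rewrite diracE; congr (_%:R%:E); congr nat_of_bool.
  by apply/idP/idP; rewrite inE /= in_itv.
by rewrite -EFinM.
Qed.

Lemma sum_eigenvalues_horner p (A : 'M[R]_p) (q : {poly R}) : A^T = A ->
  \sum_(l <- eigenvalues A) q.[l] = \sum_(i < size q) q`_i * \tr (A ^+ i).
Proof.
move=> symA; have [_ trA] := eigenvalues_symmetric symA.
under eq_bigr do rewrite horner_coef.
by rewrite exchange_big; apply: eq_bigr => i _; rewrite trA big_distrr.
Qed.

End esd_polynomials.

Section weak_convergence.
Context d (T : measurableType d) (R : realType) (P : probability T R).
Variables (B : forall p, T -> 'M[R]_p) (m : nat -> R).
Hypothesis B_sym : forall p t, (B p t)^T = B p t.
Hypothesis B_int : forall p k,
  P.-integrable setT (fun t => (\tr (B p t ^+ k))%:E).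
Hypothesis B_lim : forall k,
  phi_ P (fun t => B p t ^+ k) @[p --> \oo] --> m k.

Definition mean_poly p (q : {poly R}) : R :=
  \sum_(i < size q) q`_i * phi_ P (fun t => B p t ^+ i).

Definition limit_poly (q : {poly R}) : R := \sum_(i < size q) q`_i * m i.

Lemma limit_polyN q : limit_poly (- q) = - limit_poly q.
Proof.
rewrite /limit_poly size_polyN -sumrN; apply: eq_bigr => i _.
by rewrite coefN mulNr.
Qed.

Lemma cvg_mean_poly q : mean_poly p q @[p --> \oo] --> limit_poly q.
Proof.
rewrite /mean_poly /limit_poly; apply: cvg_big => [|i _]; first exact: add_continuous.
by apply: cvgM; [exact: cvg_cst|exact: B_lim].
Qed.

Let spectral_mean p (q : {poly R}) t : R :=
  p%:R^-1 * \sum_(l <- eigenvalues (B p t)) q.[l].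

Let spectral_meanE p q : (fun t => (spectral_mean p q t)%:E) =
  (fun t => \sum_(i < size q) ((p%:R^-1 * q`_i)%:E * (\tr (B p t ^+ i))%:E))%E.
Proof.
apply/funext => t; rewrite /spectral_mean sum_eigenvalues_horner //.
rewrite big_distrr /= -sumEFin; apply: eq_bigr => i _.
by rewrite -EFinM mulrA.
Qed.

Let integrable_spectral_mean p q :
  P.-integrable setT (fun t => (spectral_mean p q t)%:E).
Proof.
rewrite spectral_meanE; apply: integrable_sum => // i _.
exact: integrableZl.
Qed.

Let integral_spectral_mean p q :
  (\int[P]_t (spectral_mean p q t)%:E = (mean_poly p q)%:E)%E.
Proof.
rewrite spectral_meanE integral_sum //; last by move=> i; exact: integrableZl.
rewrite /mean_poly -sumEFin; apply: eq_bigr => i _.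
rewrite integralZl // /phi_ unlock mulrCA mulrA [RHS]EFinM fineK //.
exact: integrable_fin_num.
Qed.

Let esd01 p t x : 0 <= esd (B p t) x <= 1.
Proof.
rewrite esd_sum //; have [szB _] := eigenvalues_symmetric (B_sym p t).
apply/andP; split.
  by rewrite mulr_ge0 ?invr_ge0 // sumr_ge0.
have [->|p0] := posnP p; first by rewrite invr0 mul0r.
rewrite mulrC ler_pdivrMr ?ltr0n // mul1r.
apply: (@le_trans _ _ (size (eigenvalues (B p t)))%:R); last by rewrite szB.
rewrite -sum1_size natr_sum.
by apply: ler_sum => l _; case: (l <= x).
Qed.

Let integral_esd_fin p x : (\int[P]_t (esd (B p t) x)%:E \is a fin_num)%E.
Proof.
rewrite ge0_fin_numE; last first.
  by apply: integral_ge0 => t _; rewrite lee_fin; have /andP[] := esd01 p t x.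
apply: (@le_lt_trans _ _ (\int[P]_t (cst 1 t))%E).
  apply: ge0_le_integralT => t; rewrite lee_fin; by have /andP[] := esd01 p t x.
by rewrite integral_cst // mul1e (le_lt_trans (probability_le1 P _)) // ltry.
Qed.

Lemma expected_esd_le_mean_poly p q x :
  (forall t, (t <= x)%R%:R <= q.[t]) -> expected_esd P (B p) x <= mean_poly p q.
Proof.
move=> hq; rewrite /expected_esd unlock -lee_fin fineK // -integral_spectral_mean.
apply: ge0_le_integralT => t; rewrite lee_fin.
  by have /andP[] := esd01 p t x.
by rewrite esd_sum // ler_wpM2l ?invr_ge0 // ler_sum.
Qed.

Lemma mean_poly_le_expected_esd p q x :
  (forall t, q.[t] <= (t <= x)%R%:R) -> mean_poly p q <= expected_esd P (B p) x.
Proof.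
move=> hq; rewrite /expected_esd unlock -lee_fin fineK // -integral_spectral_mean.
rewrite integralE; apply: (@le_trans _ _ (\int[P]_t (fun t => (spectral_mean p q t)%:E)^\+ t)%E).
  by rewrite geeDl // leeNl oppe0 integral_ge0.
apply: ge0_le_integralT => t //; rewrite funeposE ge_max lee_fin.
rewrite lee_fin; have /andP[-> _] := esd01 p t x; rewrite andbT.
by rewrite esd_sum // ler_wpM2l ?invr_ge0 // ler_sum.
Qed.

Variables (nu : {measure set R -> \bar R}) (b : R).
Hypothesis nuT : nu setT = 1%E.
Hypothesis nu_supp : nu (~` `[- b, b]) = 0%E.
Hypothesis nu_int : forall k, nu.-integrable setT (fun x : R => (x ^+ k)%:E).
Hypothesis nu_moment : forall k, (\int[nu]_x (x ^+ k)%:E = (m k)%:E)%E.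

Let hornerE_sum (q : {poly R}) : (fun x : R => (q.[x])%:E) =
  (fun x => \sum_(i < size q) ((q`_i)%:E * (x ^+ i)%:E))%E.
Proof.
by apply/funext => x; rewrite horner_coef -sumEFin; apply: eq_bigr => i _; rewrite EFinM.
Qed.

Let integrable_horner q : nu.-integrable setT (fun x : R => (q.[x])%:E).
Proof. by rewrite hornerE_sum; apply: integrable_sum => // i _; exact: integrableZl. Qed.

Lemma integral_limit_poly q : (\int[nu]_x (q.[x])%:E = (limit_poly q)%:E)%E.
Proof.
rewrite hornerE_sum integral_sum //; last by move=> i; exact: integrableZl.
rewrite /limit_poly -sumEFin; apply: eq_bigr => i _.
by rewrite integralZl // nu_moment EFinM.
Qed.

Let nu_fin A : measurable A -> (nu A \is a fin_num)%E.
Proof.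
move=> mA; rewrite ge0_fin_numE // (@le_lt_trans _ _ (nu setT)) //.
  by apply: le_measure; rewrite ?inE.
by rewrite nuT ltry.
Qed.


(** Used with c = 1 for upper bounds and with c = -1 for lower bounds. *)
Lemma limit_poly_le q (c e : R) S : measurable S ->
  (forall t, `|t| <= b -> q.[t] <= c * \1_S t + e) ->
  limit_poly q <= c * fine (nu S) + e.
Proof.
move=> mS hq.
pose D : set R := `[- b, b]%classic.
have mD : measurable D by exact: measurable_itv.
have iS : nu.-integrable setT (EFin \o (\1_S : R -> R)).
  apply/integrableP; split; first exact/measurable_EFinP/measurable_indic.
  under eq_integral do rewrite /= ger0_norm //.
  by rewrite integral_indic // setIT -ge0_fin_numE // nu_fin.
have icst : nu.-integrable setT (EFin \o cst e).
  apply/integrableP; split; first exact/measurable_EFinP.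
  by rewrite /= integral_cst // nuT mule1 ltry.
have irhs : nu.-integrable setT (fun t => (c * \1_S t + e)%:E).
  have := integrableD measurableT (integrableZl measurableT c iS) icst.
  by apply: eq_integrable => // t _; rewrite /= EFinD EFinM.
have Erhs : (\int[nu]_t (c * \1_S t + e)%:E = (c * fine (nu S) + e)%:E)%E.
  under eq_integral do rewrite EFinD EFinM.
  rewrite integralD //; last exact: integrableZl.
  rewrite integralZl // integral_indic // setIT integral_cst // nuT mule1.
  by rewrite EFinD EFinM fineK // nu_fin.
have restrict f : nu.-integrable setT f ->
    (\int[nu]_x f x = \int[nu]_(x in D) f x)%E.
  move=> fi; rewrite (@negligible_integral _ _ _ nu setT (~` D)) //.
    by rewrite setTD setCK.
  exact: measurableC.
rewrite -lee_fin -integral_limit_poly -Erhs !restrict //.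
apply: le_integral.
- exact: mD.
- exact: (integrableS measurableT mD (@subsetT _ _) (integrable_horner q)).
- exact: (integrableS measurableT mD (@subsetT _ _) irhs).
- move=> t; rewrite inE /D /= in_itv /= => tb; rewrite lee_fin; apply: hq.
  by rewrite ler_norml.
Qed.


(** The limit law charges [-b, b] only, so a polynomial majorant of the indicator
    of ]-oo, x] that is accurate on [-b, b] has a limit mean close to the
    distribution function at a point slightly to the right of x, and a minorant one at a
    point slightly to the left. *)
Theorem weak_cvg_of_moments :
  weak_cvg_df (fun p => expected_esd P (B p)) (distribution_function nu).
Proof.
move=> x cx; pose G := distribution_function nu.
have mI z : measurable (`]-oo, z] : set R) by [].
have indE z t : \1_(`]-oo, z] : set R) t = (t <= z)%R%:R :> R.
  rewrite indicE; congr (_%:R); congr nat_of_bool.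
  by apply/idP/idP; rewrite inE /= in_itv.
apply/cvgrPdist_le => e e0.
pose h := e / 4; have h0 : 0 < h by rewrite divr_gt0.
have /cvgrPdist_lt/(_ h h0) : G y @[y --> x] --> G x by exact: cx.
move=> /nbhs_ballP[dl /= dl0 Hdl].
have near_x z : `|x - z| < dl -> `|G x - G z| < h by move=> hz; exact: Hdl.
pose s := dl / 2; have s0 : 0 < s by rewrite divr_gt0.
have sdl : s < dl by rewrite /s; lra.
have Gp : `|G x - G (x + s)| < h.
  by apply: near_x; rewrite opprD addrA subrr sub0r normrN gtr0_norm.
have Gm : `|G x - G (x - s)| < h.
  by apply: near_x; rewrite opprB addrC subrK gtr0_norm.
have xs : x < x + s by rewrite ltrDl.
have [q [q1 q2]] := threshold_poly b xs h0.
have Lq : limit_poly q <= G (x + s) + h.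
  rewrite -[X in X + h]mul1r; apply: limit_poly_le => // t tb.
  by rewrite mul1r indE q2.
(* The lower bound comes from a majorant of the indicator of [x, +oo[, that is
   of the half-line ending at -x after the change of variable t -> -t. *)
have xs' : - x < - (x - s / 2) by rewrite ltrN2; lra.
have [q' [q1' q2']] := threshold_poly b xs' h0.
pose r : {poly R} := 1 - (q' \Po - 'X).
have rE t : r.[t] = 1 - q'.[- t] by rewrite /r !hornerE horner_comp !hornerE.
have r1 t : r.[t] <= (t <= x)%R%:R.
  rewrite rE; have := q1' (- t); rewrite lerN2.
  by case: (ltgtP t x) => //= _; lra.
have Lr : G (x - s) - h <= limit_poly r.
  have : limit_poly (- r) <= (-1) * G (x - s) + h.
    apply: limit_poly_le => // t tb; rewrite hornerN rE indE.
    have := q2' (- t); rewrite normrN lerN2 => /(_ tb).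
    by case: (leP t (x - s)) => ts; case: (leP (x - s / 2) t) => ts' /=; lra.
  rewrite limit_polyN; lra.
near=> p.
have U : expected_esd P (B p) x <= mean_poly p q by exact: expected_esd_le_mean_poly.
have L : mean_poly p r <= expected_esd P (B p) x by exact: mean_poly_le_expected_esd.
have U' : `|limit_poly q - mean_poly p q| < h.
  by near: p; move/cvgrPdist_lt: (@cvg_mean_poly q); exact.
have L' : `|limit_poly r - mean_poly p r| < h.
  by near: p; move/cvgrPdist_lt: (@cvg_mean_poly r); exact.
move: Gp Gm U' L'; rewrite !ltr_norml => /andP[g1 g2] /andP[g3 g4] /andP[u1 u2] /andP[l1 l2].
rewrite ler_norml -/G; apply/andP; split; rewrite /h in g1 g2 g3 g4 u1 u2 l1 l2 Lq Lr; lra.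
Unshelve. all: by end_near. Qed.

End weak_convergence.


(** * The free Poisson element and the main theorem *)
Section moment_functional.
Context (R : realType) (nu : {measure set R -> \bar R}) (m : nat -> R).
Hypothesis nu_int : forall k, nu.-integrable setT (fun x : R => (x ^+ k)%:E).
Hypothesis nu_moment : forall k, (\int[nu]_x (x ^+ k)%:E = (m k)%:E)%E.
Hypothesis m0 : m 0%N = 1.

Local Notation c := (real_complex R).

Definition poly_star (q : {poly R[i]}) : {poly R[i]} := map_poly conjc q.

Definition moment_functional (q : {poly R[i]}) : R[i] :=
  \sum_(i < size q) q`_i * c (m i).

Lemma moment_functionalE N (q : {poly R[i]}) : (size q <= N)%N ->
  moment_functional q = \sum_(i < N) q`_i * c (m i).
Proof.
move=> qN; rewrite /moment_functional (big_ord_widen N (fun i => q`_i * c (m i))) //.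
rewrite big_mkcond; apply: eq_bigr => i _; case: ltnP => // iN.
by rewrite nth_default // mul0r.
Qed.

Lemma moment_functional_is_scalar : scalar moment_functional.
Proof.
move=> a u v; pose N := maxn (size u) (size v).
have sN : (size (a *: u + v)%R <= N)%N.
  rewrite (leq_trans (size_polyD _ _)) // geq_max leq_maxr andbT.
  by rewrite (leq_trans (size_scale_leq _ _)) // leq_maxl.
rewrite !(@moment_functionalE N) ?leq_maxl ?leq_maxr //.
rewrite big_distrr -big_split /=; apply: eq_bigr => i _.
by rewrite coefD coefZ mulrDl mulrA.
Qed.

HB.instance Definition _ := GRing.isLinear.Build R[i] {poly R[i]} R[i] *%R
  moment_functional moment_functional_is_scalar.

Lemma moment_functionalXn k : moment_functional 'X^k = c (m k).
Proof.
rewrite /moment_functional size_polyXn big_ord_recr /= coefXn eqxx mul1r.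
rewrite big1 ?add0r // => i _.
by rewrite coefXn eqn_leq [(k <= i)%N]leqNgt ltn_ord andbF mul0r.
Qed.

Lemma moment_functional_real (q : {poly R}) :
  moment_functional (map_poly c q) = c (limit_poly m q).
Proof.
rewrite /moment_functional size_map_poly /limit_poly rmorph_sum.
by apply: eq_bigr => i _; rewrite coef_map rmorphM.
Qed.

Lemma limit_poly_ge0 (q : {poly R}) : (forall x, 0 <= q.[x]) -> 0 <= limit_poly m q.
Proof.
move=> q0; rewrite -lee_fin -(integral_limit_poly nu_int nu_moment).
by apply: integral_ge0 => x _; rewrite lee_fin.
Qed.


(** If x = u + iv with u and v real polynomials, then x* x = u^2 + v^2. *)
Lemma moment_functional_ge0 x : 0 <= moment_functional (poly_star x * x).
Proof.
pose u : {poly R} := \poly_(i < size x) complex.Re x`_i.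
pose v : {poly R} := \poly_(i < size x) complex.Im x`_i.
have uE i : u`_i = complex.Re x`_i.
  by rewrite coef_poly; case: ltnP => // xi; rewrite nth_default.
have vE i : v`_i = complex.Im x`_i.
  by rewrite coef_poly; case: ltnP => // xi; rewrite nth_default.
clearbody u v.
have xE : x = map_poly c u + 'i%C *: map_poly c v.
  apply/polyP => i; rewrite coefD coefZ !coef_map uE vE.
  exact: complexE.
have sE : poly_star x = map_poly c u - 'i%C *: map_poly c v.
  apply/polyP => i; rewrite coefB coefZ !coef_map uE vE /=.
  by case: (x`_i) => p q; apply/eqP; rewrite eq_complex /=; apply/andP; split; apply/eqP; ring.
have -> : poly_star x * x = map_poly c (u ^+ 2 + v ^+ 2).
  rewrite sE [X in _ * X]xE rmorphD !rmorphXn /=.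
  rewrite mulrDr !mulrBl -!scalerAl -!scalerAr scalerA.
  have -> : 'i%C * 'i%C = -1 :> R[i] by rewrite -expr2 sqr_i.
  rewrite scaleN1r !expr2 [map_poly c v * map_poly c u]mulrC opprK.
  by ring.
rewrite moment_functional_real ler0c limit_poly_ge0 // => t.
by rewrite hornerD !horner_exp addr_ge0 // sqr_ge0.
Qed.

Definition moment_space : ncProbSpace R.
Proof.
refine (@NCProbSpace R {poly R[i]} poly_star _ _ _ _ moment_functional _ _).
- by move=> q; apply/polyP => i; rewrite !coef_map /= conjcK.
- by move=> p q; rewrite /poly_star rmorphD.
- by move=> p q; rewrite /poly_star rmorphM mulrC.
- by move=> a q; rewrite /poly_star map_polyZ.
- by have := moment_functionalXn 0; rewrite expr0 m0.
- exact: moment_functional_ge0.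
Defined.

End moment_functional.

Lemma cvg_real_complex (R : realType) (u : nat -> R) (l : R) :
  u n @[n --> \oo] --> l ->
  (real_complex R (u n) : R[i]^o) @[n --> \oo] --> (real_complex R l : R[i]^o).
Proof.
move=> ul; apply/cvgrPdist_lt => e; rewrite ltcE /= => /andP[/eqP e_im e_re].
have -> : e = (complex.Re e)%:C%C by case: e e_im e_re => a b /= -> _.
near=> n; rewrite -rmorphB normc_def /= expr0n addr0 sqrtr_sqr ltcR.
by near: n; move/cvgrPdist_lt: ul; exact.
Unshelve. all: by end_near. Qed.

Theorem theorem3 (R : realType) (d : measure_display) (T : measurableType d)
    (P : probability T R) (rho : nat -> R) (a : nat -> nat -> {RV P >-> R})
    (n : nat -> nat) (y : R)
    (a_indep : independent_entries P (fun i j => a i j : T -> R))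
    (a_mean : forall i j : nat, ('E_P[a i j] = 0)%E)
    (a_var : forall i j : nat, ('E_P[fun t => (a i j t ^+ 2)%R] = 1)%E)
    (a_moments : forall q : nat,
      (ereal_sup (range (fun ij : nat * nat =>
         'E_P[fun t => (`|a ij.1 ij.2 t| ^+ q)%R])) < +oo)%E)
    (a_corr : forall i j : nat, i != j ->
      ('E_P[fun t => (a i j t * a j i t)%R] = (rho `|i - j|%N)%:E)%E)
    (y_gt0 : 0 < y)
    (n_lim : (p%:R / (n p)%:R : R) @[p --> \oo] --> y) :
  (exists (A : ncProbSpace R) (b : A),
     free_poisson y b /\
     cvg_in_distribution P
       (fun p => sample_covariance (fun i j => a i j : T -> R) p (n p)) b) /\
  weak_cvg_df
    (fun p => expected_esd P
       (sample_covariance (fun i j => a i j : T -> R) p (n p)))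
    (distribution_function (marchenko_pastur y)).
Proof.
pose m k : R := path_weight 1 y true k.*2 0.
have mp_int := integrable_marchenko_pasturX y_gt0.
have mp_moment := marchenko_pastur_moments y_gt0.
have moments := sample_covariance_moments a_indep a_mean a_var a_moments y_gt0 n_lim.
have m0 : m 0%N = 1 by [].
split.
  exists (moment_space mp_int mp_moment m0), 'X; split.
    split=> [|k]; first by rewrite /nc_selfadjoint /= /poly_star map_polyX.
    by rewrite /= moment_functionalXn /Rintegral mp_moment.
  move=> k; rewrite /= moment_functionalXn.
  exact: cvg_real_complex (moments k).
apply: (@weak_cvg_of_moments _ _ _ P _ m _ _ _ (marchenko_pastur y) (mp_right y)) => //.
- move=> p t; by rewrite /sample_covariance linearZ /= trmx_mul trmxK.
- by move=> p k; exact: integrable_trace_sample_covariance.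
- exact: marchenko_pastur_setT.
- apply: (subset_measure0 _ _ _ (marchenko_pastur_support y_gt0)).
  + exact: measurableC.
  + exact: measurableC.
  + apply: subsetC => x /=; rewrite !in_itv /= => /andP[x0 ->]; rewrite andbT.
    by rewrite (le_trans _ x0) // oppr_le0 ltW // mp_right_gt0.
Qed.
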